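(* For integers $r\ge 2$ and even $n\ge 4$, let $P^r_n\subset\mathbb{R}^{2r}$ be a realization of a product of $n$-gons $(P_n)^r$, that is, a $2r$-dimensional convex polytope combinatorially equivalent to $(P_n)^r$, such that the projection $\pi:\mathbb{R}^{2r}\to\mathbb{R}^4$ to the last $4$ coordinates is generic with respect to $P^r_n$, and such that all the vertices, all the edges and all the polygon $2$-faces of $P^r_n$ survive the projection $\pi$. Then $\pi(P^r_n)\subset\mathbb{R}^4$ is a $4$-polytope with $f$-vector $$f(\pi(P^r_n))=\Big(n^r,\ rn^r,\ \tfrac54 rn^r-\tfrac32 n^r+rn^{r-1},\ \tfrac14 rn^r-\tfrac12 n^r+rn^{r-1}\Big)=\Big(\tfrac4r,\ 4,\ 5-\tfrac6r+\tfrac4n,\ 1-\tfrac2r+\tfrac4n\Big)\cdot\tfrac14 rn^r.$$ In particular, for $n,r\to\infty$ the fatness $F(\pi(P^r_n))$ gets arbitrarily close to $9$.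
   Context: All polytopes are convex. A $d$-polytope is a $d$-dimensional polytope. The $f$-vector of a $4$-polytope $P$ is $f(P)=(f_0,f_1,f_2,f_3)$, where $f_i$ is the number of $i$-dimensional faces of $P$. The fatness of a $4$-polytope $P$ (not a simplex) is $$F(P):=\frac{f_1+f_2-20}{f_0+f_3-10}.$$ $P_n\subset\mathbb{R}^2$ denotes a convex $n$-gon, and $(P_n)^r\subset\mathbb{R}^{2r}$ is the product of $r$ copies of it; its nonempty faces are the products $G_1\times\cdots\times G_r$ of nonempty faces $G_i$ of the factors. A polygon $2$-face of $(P_n)^r$ is a $2$-face that is the product of one entire $n$-gon factor with vertices of all other factors (the other $2$-faces, products of two edges with vertices of the other factors, are the quadrilateral $2$-faces). For a polytope $P^r_n$ combinatorially equivalent to $(P_n)^r$, fix an isomorphism of face lattices; its polygon $2$-faces are the faces corresponding to the polygon $2$-faces of $(P_n)^r$. Let $P\subset\mathbb{R}^{m}$ be a polytope and $\pi:\mathbb{R}^{m}\to\mathbb{R}^{4}$ a surjective linear projection. A face $G$ of $P$ survives the projection (is strictly preserved) if $\pi(G)$ is a face of $\pi(P)$, $P\cap\pi^{-1}(\pi(G))=G$, and $\pi$ is injective on $G$ (so that $\pi(G)$ is an isomorphic copy of $G$). The projection is generic with respect to $P$ if the direction of projection is in general position with respect to the edges of $P$; in particular, the proper faces of $\pi(P)$ are then exactly the images $\pi(G)$ of the faces $G$ of $P$ that survive the projection (for each proper face $H$ of $\pi(P)$, the set $P\cap\pi^{-1}(H)$ is a face of $P$ that is mapped isomorphically to $H$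 by $\pi$). *)

(* Defs.v *)
(* MathComp, with classical sets and real numbers from MathComp-Analysis *)
From mathcomp Require Import all_boot all_order all_algebra finmap.
From mathcomp Require Import boolp classical_sets functions cardinality reals.

Set Implicit Arguments.
Unset Strict Implicit.
Unset Printing Implicit Defensive.

Import Order.TTheory GRing.Theory Num.Theory.

Local Open Scope classical_set_scope.
Local Open Scope ring_scope.

Section Polytopes.
Variables (R : realType) (m : nat).
Implicit Types (S P F G : set 'rV[R]_m).

Definition affine_hull S : set 'rV[R]_m :=
  [set x | exists (k : nat) (v : 'I_k -> 'rV[R]_m) (a : 'I_k -> R),
    [/\ forall i, S (v i), \sum_i a i = 1 & x = \sum_i a i *: v i]].

Definition convex_hull S : set 'rV[R]_m :=
  [set x | exists (k : nat) (v : 'I_k -> 'rV[R]_m) (a : 'I_k -> R),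
    [/\ forall i, S (v i), forall i, 0 <= a i, \sum_i a i = 1
      & x = \sum_i a i *: v i]].

Definition is_polytope P : Prop :=
  exists V : set 'rV[R]_m, finite_set V /\ P = convex_hull V.

(* The affine hull of S is x0 + (row space of D), with \rank D = d.  No d is
   a dimension of the empty set. *)
Definition has_dim S (d : nat) : Prop :=
  exists (x0 : 'rV[R]_m) (D : 'M[R]_m),
    \rank D = d /\ affine_hull S = [set x | (x - x0 <= D)%MS].

Definition is_dpolytope (d : nat) P : Prop := is_polytope P /\ has_dim P d.

(* c = 0 yields the improper faces P (for b = 0) and set0 (for b = 1). *)
Definition is_face P F : Prop :=
  exists (c : 'cV[R]_m) (b : R),
    (forall x, P x -> (x *m c) 0 0 <= b) /\
    F = P `&` [set x | (x *m c) 0 0 = b].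

Definition faces P : set (set 'rV[R]_m) := [set F | is_face P F].

Definition dfaces (d : nat) P : set (set 'rV[R]_m) :=
  [set F | is_face P F /\ has_dim F d].

Definition nfaces (d : nat) P : nat := #|` fset_set (dfaces d P)|.

End Polytopes.

Definition row4 (R : realType) (a b c d : R) : 'rV[R]_4 :=
  \row_(i < 4) [:: a; b; c; d]`_i.

Definition fvector (R : realType) (Q : set 'rV[R]_4) : 'rV[R]_4 :=
  \row_(i < 4) (nfaces i Q)%:R.

Definition fatness (R : realType) (Q : set 'rV[R]_4) : R :=
  ((nfaces 1 Q)%:R + (nfaces 2 Q)%:R - 20) /
  ((nfaces 0 Q)%:R + (nfaces 3 Q)%:R - 10).

(* An isomorphism of face lattices; the empty face and the whole polytope are
   included. *)
Definition face_lattice_iso (R : realType) (m m' : nat)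
    (P : set 'rV[R]_m) (P' : set 'rV[R]_m')
    (phi : set 'rV[R]_m -> set 'rV[R]_m') : Prop :=
  set_bij (faces P) (faces P') phi /\
  forall F G, faces P F -> faces P G -> (F `<=` G <-> phi F `<=` phi G).

Section Projections.
Variables (R : realType) (m k : nat).

(* The linear map with matrix A, acting on row vectors on the right. *)
Definition proj (A : 'M[R]_(m, k)) (x : 'rV[R]_m) : 'rV[R]_k := x *m A.

(* For k <= m: the projection to the last k coordinates. *)
Definition last_coords : 'M[R]_(m, k) :=
  \matrix_(i, j) (i == (m - k + j)%N :> nat)%:R.

Definition survives (A : 'M[R]_(m, k)) (P G : set 'rV[R]_m) : Prop :=
  [/\ is_face (proj A @` P) (proj A @` G),
      P `&` proj A @^-1` (proj A @` G) = G
    & set_inj G (proj A)].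

(* The direction of projection ker A is in general position with respect to
   the edges of P: it meets every subspace U spanned by edge directions in
   the expected dimension max(0, dim U + dim (ker A) - m), here obtained by
   truncated subtraction. *)
Definition generic_projection (A : 'M[R]_(m, k)) (P : set 'rV[R]_m) : Prop :=
  forall (s : nat) (D : 'M[R]_(s, m)),
    (forall i, exists (E : set 'rV[R]_m) (x y : 'rV[R]_m),
       [/\ dfaces 1 P E, E x, E y & row i D = y - x]) ->
    \rank (D :&: kermx A)%MS = (\rank D + \rank (kermx A) - m)%N.

End Projections.

(* A point of (R^2)^r is encoded in 'rV_(r * 2); its i-th component is the
   i-th row of the r x 2 matrix vec_mx x. *)
Definition prod_set (R : realType) (r : nat) (G : 'I_r -> set 'rV[R]_2) :
    set 'rV[R]_(r * 2) :=
  [set x | forall i, G i (row i (vec_mx x))].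

Definition is_ngon (R : realType) (n : nat) (Pn : set 'rV[R]_2) : Prop :=
  is_dpolytope 2 Pn /\ nfaces 0 Pn = n.

Definition polygon_face (R : realType) (r : nat) (Pn : set 'rV[R]_2)
    (G : set 'rV[R]_(r * 2)) : Prop :=
  exists (i : 'I_r) (V : 'I_r -> set 'rV[R]_2),
    (forall j, dfaces 0 Pn (V j)) /\
    G = prod_set (fun j => if j == i then Pn else V j).

Definition pi4 (R : realType) (m : nat) : 'rV[R]_m -> 'rV[R]_4 :=
  proj (last_coords R m 4).

(* phi is the isomorphism of face lattices that identifies the polygon 2-faces
   of P. *)
Record projectable_product (R : realType) (r n : nat) (Pn : set 'rV[R]_2)
    (phi : set 'rV[R]_(r * 2) -> set 'rV[R]_(r * 2))
    (P : set 'rV[R]_(r * 2)) : Prop := ProjectableProduct {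
  factor_ngon : is_ngon n Pn;
  realization_dim : is_dpolytope (r * 2) P;
  realization_iso : face_lattice_iso (prod_set (fun _ : 'I_r => Pn)) P phi;
  realization_generic : generic_projection (last_coords R (r * 2) 4) P;
  vertices_survive : forall G, dfaces 0 P G ->
    survives (last_coords R (r * 2) 4) P G;
  edges_survive : forall G, dfaces 1 P G ->
    survives (last_coords R (r * 2) 4) P G;
  polygons_survive : forall G, polygon_face Pn G ->
    survives (last_coords R (r * 2) 4) P (phi G)
}.

(* Main.v *)
Require Import Defs.
From mathcomp Require Import all_boot all_order all_algebra finmap lra ring zify.
From mathcomp Require Import boolp.

(** Let Q be the image of P in 4-space. A face of Q is the image of the part of
    P on which a functional pulled back from 4-space is maximal. So the f-vector
    of Q counts, by dimension, the faces of P that are exposed by such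
    functionals, and the faces of P are known: they correspond to the faces of
    a product of polygons. The counting is done at one vertex at a time.

    At a vertex x of P choose a point x + delta_j on each of the 2r edges. The
    2r facets at x, each missing exactly one of these edges, are exposed by
    functionals that are, up to scaling, dual to the delta_j. Hence the delta_j
    form a basis, P lies in the cone that they generate at x, and the face
    spanned by a set S of edges is the part of P on which the coordinates
    outside S vanish ([exists_corner]). It follows that this face survives if
    and only if some functional on 4-space vanishes on the projected directions
    in S and is negative on the others ([corner_shadow]). So the surviving faces
    at x are the faces of the cone over 2r vectors in 4-space, and genericity
    says that any four of these vectors are independent
    ([corner_general_position]).

    The combinatorial core, which takes the place of the Euler relation for Q,
    is that the cone over N extreme vectors in general position in 4-space has
    2N - 4 facets ([card_facets_dim3]). The facets are the vertices of a simple
    3-polytope, namely a slice of the dual cone, and they are counted as one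
    computes an h-vector: a generic linear form g has exactly one minimum on
    each face of the slice ([card_positive_outside]), and g has three signs at
    each vertex of the slice, one for each edge that leaves it.

    Every ridge lies in exactly two facets ([card_facets_ridge]), and by
    hypothesis all vertices, edges and polygons survive. This determines the
    numbers of surviving faces at a vertex: 2r edges, r polygons, 5r - 6
    quadrilaterals, 2r prisms over polygons and 2r - 4 cubes. As a product of a
    polygons and b edges has n ^ a * 2 ^ b vertices, counting pairs of a vertex
    and a face through it ([double_count]) gives the f-vector. *)

Set Implicit Arguments.
Unset Strict Implicit.
Unset Printing Implicit Defensive.

Import Order.TTheory GRing.Theory Num.Theory.

Local Open Scope ring_scope.

(** * Functionals, dual bases and the ratio test *)

Definition dot (F : fieldType) m (x : 'rV[F]_m) (c : 'cV[F]_m) : F :=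
  (x *m c) 0 0.

Section Dot.
Variables (F : fieldType) (m : nat).
Implicit Types (x y : 'rV[F]_m) (c w : 'cV[F]_m).

Lemma dotDl x y c : dot (x + y) c = dot x c + dot y c.
Proof. by rewrite /dot mulmxDl mxE. Qed.

Lemma dotDr x c w : dot x (c + w) = dot x c + dot x w.
Proof. by rewrite /dot mulmxDr mxE. Qed.

Lemma dotNl x c : dot (- x) c = - dot x c.
Proof. by rewrite /dot mulNmx mxE. Qed.

Lemma dotNr x c : dot x (- c) = - dot x c.
Proof. by rewrite /dot mulmxN mxE. Qed.

Lemma dotBl x y c : dot (x - y) c = dot x c - dot y c.
Proof. by rewrite dotDl dotNl. Qed.

Lemma dotBr x c w : dot x (c - w) = dot x c - dot x w.
Proof. by rewrite dotDr dotNr. Qed.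

Lemma dotZl a x c : dot (a *: x) c = a * dot x c.
Proof. by rewrite /dot -scalemxAl mxE. Qed.

Lemma dotZr a x c : dot x (a *: c) = a * dot x c.
Proof. by rewrite /dot -scalemxAr mxE. Qed.

Lemma dot0l c : dot 0 c = 0.
Proof. by rewrite /dot mul0mx mxE. Qed.

Lemma dot0r x : dot x 0 = 0.
Proof. by rewrite /dot mulmx0 mxE. Qed.

Lemma dot_suml (I : Type) (r : seq I) (P : pred I) (X : I -> 'rV[F]_m) c :
  dot (\sum_(i <- r | P i) X i) c = \sum_(i <- r | P i) dot (X i) c.
Proof. by apply: (big_morph (fun x => dot x c)) => [x y|]; rewrite (dotDl, dot0l). Qed.

Lemma dotE x c : dot x c = \sum_i x 0 i * c i 0.
Proof. by rewrite /dot mxE. Qed.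

Lemma dot_mul n x (A : 'M_(m, n)) (c : 'cV_n) : dot (x *m A) c = dot x (A *m c).
Proof. by rewrite /dot mulmxA. Qed.

Lemma dot_inj c : (forall x, dot x c = 0) -> c = 0.
Proof.
move=> c0; apply/matrixP=> i j; rewrite ord1 !mxE.
by have := c0 (delta_mx 0 i); rewrite /dot -rowE mxE.
Qed.

Lemma exists_annihilator (K : finType) (b : K -> 'rV[F]_m) :
  (#|K| < m)%N -> exists2 u : 'cV_m, u != 0 & forall k, dot (b k) u = 0.
Proof.
move=> ltKm; pose B := \matrix_(k < #|K|) b (enum_val k).
have : kermx B^T != 0.
  rewrite -mxrank_eq0 mxrank_ker mxrank_tr subn_eq0 -ltnNge.
  exact: leq_ltn_trans (rank_leq_row _) ltKm.
case/rowV0Pn=> v /sub_kermxP vB v0; exists v^T; first by rewrite trmx_eq0.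
move=> k; have : (v *m B^T)^T = 0 by rewrite vB trmx0.
rewrite trmx_mul trmxK => /matrixP /(_ (enum_rank k) 0).
rewrite /dot !mxE => vBk; rewrite -[RHS]vBk; apply: eq_bigr => i _.
by rewrite !mxE enum_rankK.
Qed.

End Dot.

Lemma dual_basis (F : fieldType) m (K : finType) (b : K -> 'rV[F]_m) :
  #|K| = m -> (forall w, (forall k, dot (b k) w = 0) -> w = 0) ->
  exists2 u : K -> 'cV[F]_m, forall k l, dot (b k) (u l) = (k == l)%:R
    & forall x, x = \sum_k dot x (u k) *: b k.
Proof.
move=> Km; case: _ / Km b => b b0; pose B := \matrix_(k < #|K|) b (enum_val k).
have Bu : B \in unitmx.
  rewrite -unitmx_tr -row_free_unit; apply: inj_row_free => v vB.
  apply: trmx_inj; rewrite trmx0; apply: b0 => k.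
  have : (v *m B^T)^T = 0 by rewrite vB trmx0.
  rewrite trmx_mul trmxK => /matrixP /(_ (enum_rank k) 0).
  rewrite /dot !mxE => vBk; rewrite -[RHS]vBk; apply: eq_bigr => i _.
  by rewrite !mxE enum_rankK.
exists (fun k => col (enum_rank k) (invmx B)).
  move=> k l; rewrite /dot !mxE.
  have := congr1 (fun M : 'M_ _ => M (enum_rank k) (enum_rank l)) (mulmxV Bu).
  rewrite !mxE (inj_eq enum_rank_inj) => BB; rewrite -[RHS]BB.
  apply: eq_bigr => i _.
  by rewrite !mxE enum_rankK.
move=> x; rewrite -{1}[x](mulmxKV Bu) mulmx_sum_row.
rewrite (reindex enum_rank) /=; last exact/onW_bij/enum_rank_bij.
apply: eq_bigr => k _; rewrite rowK enum_rankK; congr (_ *: _).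
by rewrite /dot !mxE; apply: eq_bigr => i _; rewrite !mxE.
Qed.

(** A point of the moment curve is orthogonal to a given nonzero vector for
    finitely many parameters only: these are the roots of a nonzero polynomial. *)
Lemma generic_vector (R : realFieldType) m (K : finType) (w : K -> 'cV[R]_m) :
  exists g : 'rV[R]_m, forall k, w k != 0 -> dot g (w k) != 0.
Proof.
pose P k : {poly R} := \poly_(i < m) oapp (fun i => w k i 0) 0 (insub i).
have PE k t : (P k).[t] = dot (\row_(i < m) t ^+ i) (w k).
  rewrite horner_poly dotE; apply: eq_bigr => i _.
  by rewrite mxE valK /= mulrC.
have P0 k : w k != 0 -> P k != 0.
  apply: contra_neqN => /eqP Pk; apply/matrixP=> i j; rewrite ord1 mxE.
  by have := congr1 (fun p : {poly R} => p`_i) Pk; rewrite coef_poly coef0 ltn_ord valK.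
pose Q := \prod_(k | w k != 0) P k.
have Q0 : Q != 0 by apply/prodf_neq0 => k /P0.
pose s := [seq i%:R : R | i <- iota 0 (size Q)].
have us : uniq s by rewrite map_inj_uniq ?iota_uniq //; exact: mulrIn (oner_neq0 R).
have /allPn [t _ rt] : ~~ all (root Q) s.
  apply/negP=> /(max_poly_roots Q0)/(_ us).
  by rewrite size_map size_iota ltnn.
exists (\row_(i < m) t ^+ i) => k wk; rewrite -PE; apply: contraNN rt.
by rewrite /root /Q (bigD1 k) //= hornerM => /eqP ->; rewrite mul0r.
Qed.

Section RatioTest.
Variables (R : realFieldType) (J : finType).
Implicit Types x y : J -> R.

(** Moving from x in the direction y, the first coordinate to vanish is one
    with the least ratio of x j to - y j; the condition on the zeros of x is what
    allows a move of positive length. *)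
Lemma ratio_test x y :
  (forall j, 0 <= x j) -> (forall j, x j = 0 -> 0 <= y j) ->
  (exists j, y j < 0) ->
  exists t, [/\ 0 < t, forall j, 0 <= x j + t * y j
    & exists2 j, y j < 0 & x j + t * y j = 0].
Proof.
move=> x0 y0 [j0 j0P].
have [j yj jmin] :=
  @arg_minP _ _ _ j0 (fun j => y j < 0) (fun j => x j / - y j) j0P.
exists (x j / - y j); split.
- rewrite divr_gt0 ?oppr_gt0 // lt_neqAle x0 andbT eq_sym.
  by apply: contraTneq yj => /y0; rewrite leNgt.
- move=> i; have [yi|yi] := ltP (y i) 0; last first.
    by rewrite addr_ge0 ?x0 // mulr_ge0 // divr_ge0 // oppr_ge0 ltW.
  have := jmin _ yi; rewrite ler_pdivlMr ?oppr_gt0 // mulrN.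
  by rewrite -subr_ge0 opprK.
- exists j => //; rewrite invrN mulrN mulNr -mulrA mulVf ?mulr1 ?subrr //.
  by rewrite lt_eqF.
Qed.

(** When a decreasing coordinate has reached 0 at time t, no other time at
    which all coordinates are nonnegative can exceed t. *)
Lemma ratio_test_uniq x y t s :
  (forall j, 0 <= x j + t * y j) -> (exists2 j, y j < 0 & x j + t * y j = 0) ->
  (forall j, 0 <= x j + s * y j) -> (exists2 j, y j < 0 & x j + s * y j = 0) ->
  t = s.
Proof.
move=> t0 [i yi ti] s0 [j yj sj]; apply/eqP; rewrite eq_le.
have := t0 j; rewrite -sj lerD2l ler_nM2r // => ->.
by have := s0 i; rewrite -ti lerD2l ler_nM2r // => ->.
Qed.

End RatioTest.

(** * Cones over vectors in general position *)

Section Configuration.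
Variables (R : realFieldType) (J : finType) (d : nat) (p : J -> 'rV[R]_d.+1).
Implicit Types (c w : 'cV[R]_d.+1) (S T : {set J}).

(** Dually: any d + 1 of the vectors generate the space. *)
Definition general_position : Prop :=
  forall T c, (d < #|T|)%N -> {in T, forall j, dot (p j) c = 0} -> c = 0.

Let q := \sum_j p j.

(** The face S of the cone over the vectors p, together with a functional c
    that exposes it. Scaling c to be 1 at the centre q turns the dual cone into a
    bounded slice and makes c unique when S is a facet. *)
Definition exposes c S : Prop :=
  [/\ dot q c = 1, {in S, forall j, dot (p j) c = 0}
    & forall j, j \notin S -> 0 < dot (p j) c].

Definition cone_face S : Prop := exists c, exposes c S.

Lemma exposes_ge0 c S j : exposes c S -> 0 <= dot (p j) c.
Proof.
case=> _ c0 cp; have [/c0 ->//|/cp/ltW//] := boolP (j \in S).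
Qed.

Lemma dot_centre c : dot q c = \sum_j dot (p j) c.
Proof. exact: dot_suml. Qed.

Lemma cone_faceI c S : S != [set: J] -> {in S, forall j, dot (p j) c = 0} ->
  (forall j, j \notin S -> 0 < dot (p j) c) -> cone_face S.
Proof.
rewrite -subTset => /subsetPn [i _ iS] c0 cp.
have qc : 0 < dot q c.
  rewrite dot_centre lt_neqAle sumr_ge0 ?andbT => [|j _]; last first.
    have [/c0 ->//|/cp/ltW//] := boolP (j \in S).
  rewrite eq_sym; apply/eqP => /psumr_eq0P H.
  have := cp i iS; rewrite H ?ltxx // => j _.
  by have [/c0 ->//|/cp/ltW//] := boolP (j \in S).
exists ((dot q c)^-1 *: c); split=> [|j jS|j jS]; rewrite dotZr.
- by rewrite mulVf // gt_eqF.
- by rewrite c0 // mulr0.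
- by rewrite mulr_gt0 ?invr_gt0 // cp.
Qed.

Lemma exposes_inj c S S' : exposes c S -> exposes c S' -> S = S'.
Proof.
move=> [_ c0 cp] [_ c0' cp']; apply/setP=> j; apply/idP/idP => jS.
  by apply: contraPT (c0 j jS) => /cp' /gt_eqF /eqP.
by apply: contraPT (c0' j jS) => /cp /gt_eqF /eqP.
Qed.

Hypotheses (gp : general_position) (ltdJ : (d < #|J|)%N).

Lemma card_cone_face S : cone_face S -> (#|S| <= d)%N.
Proof.
case=> c [qc c0 _]; rewrite leqNgt; apply/negP => /gp /(_ c0) c00.
by move: qc; rewrite c00 dot0r => /eqP; rewrite eq_sym oner_eq0.
Qed.

(** The direction u vanishes at the centre but not on all vectors, so it is
    negative on some of them; tilting c along u until the first of these is
    reached gives the new face. *)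
Lemma cone_face_rotate c S u : exposes c S -> {in S, forall j, 0 <= dot (p j) u} ->
  dot q u = 0 -> (exists j, dot (p j) u != 0) ->
  exists t, exists2 S', 0 < t &
    exposes (c + t *: u) S' /\ exists2 b, dot (p b) u < 0 & b \in S'.
Proof.
move=> eS u0 qu [i ui].
have [j uj] : exists j, dot (p j) u < 0.
  apply: contrapT => /forallNP un; have {}un j : 0 <= dot (p j) u.
    by rewrite leNgt; apply/negP/un.
  by move: qu ui; rewrite dot_centre => /psumr_eq0P -> //; rewrite eqxx.
have [qc c0 cp] := eS.
have [|||t [t0 tge [b ub tb]]] :=
  @ratio_test _ _ (fun j => dot (p j) c) (fun j => dot (p j) u).
- by move=> k; exact: exposes_ge0 eS.
- move=> k ck; apply: u0; apply: contraPT ck => /cp /gt_eqF /eqP //.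
- by exists j.
exists t, [set k | dot (p k) (c + t *: u) == 0] => //.
split; last by exists b; rewrite // inE dotDr dotZr tb.
split=> [|k|k]; first by rewrite dotDr dotZr qu mulr0 addr0.
  by rewrite inE => /eqP.
by rewrite inE => kS; rewrite lt_neqAle eq_sym kS dotDr dotZr tge.
Qed.

(** As long as S has fewer than d elements, some nonzero functional vanishes
    on S and at the centre, and tilting along it enlarges S. *)
Lemma exists_cone_facet S : cone_face S ->
  exists2 T, cone_face T & S \subset T /\ #|T| = d.
Proof.
have [k] := ubnP (d - #|S|); elim: k S => // k IHk S /ltnSE leSk fS.
have [ltSd|leSd] := ltnP #|S| d; last first.
  by exists S => //; split=> //; apply/eqP; rewrite eqn_leq card_cone_face.
have [c eS] := fS.
pose b (o : option {j | j \in S}) := if o is Some j then p (val j) else q.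
have [|u u0 bu] := exists_annihilator b; first by rewrite card_option card_sig.
have uS : {in S, forall j, dot (p j) u = 0}.
  by move=> j jS; have := bu (Some (exist _ j jS)).
have [||t [S' _ [eS' [j uj jS']]]] := cone_face_rotate (u := u) eS _ (bu None).
- by move=> j /uS ->.
- apply: contrapT => /forallNP un; case/negP: u0; apply/eqP.
  apply: (gp (T := [set: J])) => [|j _]; first by rewrite cardsT.
  by apply/eqP/negPn/negP/un.
have SS' : S \subset S'.
  apply/subsetP=> i iS; have [_ c0 _] := eS; have [_ _ c'p] := eS'.
  by apply: contraT => /c'p; rewrite dotDr dotZr c0 // uS // mulr0 addr0 ltxx.
have jS : j \notin S by apply: contraTN uj => /uS ->; rewrite ltxx.
have fS' : cone_face S' by exists (c + t *: u).
have ltSS' : (#|S| < #|S'|)%N.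
  by apply: proper_card; rewrite properE SS'; apply/subsetPn; exists j.
have [|T fT [S'T cT]] := IHk S' _ fS'.
  by apply: leq_trans leSk; rewrite ltn_sub2l.
by exists T => //; split=> //; exact: subset_trans SS' S'T.
Qed.

(** The vectors in T and the centre q form a basis of the space, and u and c
    are the dual basis. *)
Definition frame c (u : J -> 'cV[R]_d.+1) T : Prop :=
  [/\ exposes c T, {in T, forall a, dot q (u a) = 0},
      {in T &, forall b a, dot (p b) (u a) = (b == a)%:R}
    & forall x, x = \sum_(a in T) dot x (u a) *: p a + dot x c *: q].

(** The point is that a functional w that vanishes on T and at the centre is
    0. For j outside T the combination of w and c that vanishes at p j vanishes on
    d + 1 vectors, hence is 0, and its value at the centre shows that w vanishes
    at p j as well. *)
Lemma exists_frame c T : exposes c T -> #|T| = d -> exists u, frame c u T.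
Proof.
move=> eT cT; have [qc c0 cp] := eT.
pose b (o : option {j | j \in T}) := if o is Some j then p (val j) else q.
have [j jT] : exists j, j \notin T.
  have : [exists j, j \notin T]; last by case/existsP=> j; exists j.
  apply: contraLR ltdJ; rewrite negb_exists -leqNgt -cT => /forallP T1.
  by rewrite -cardsT subset_leq_card //; apply/subsetP=> j _; have := T1 j; rewrite negbK.
have b0 w : (forall k, dot (b k) w = 0) -> w = 0.
  move=> bw; have wT : {in T, forall j, dot (p j) w = 0}.
    by move=> i iT; have := bw (Some (exist _ i iT)).
  have : dot (p j) c *: w - dot (p j) w *: c = 0.
    apply: (gp (T := j |: T)) => [|i]; first by rewrite cardsU1 jT cT.
    rewrite in_setU1 dotBr !dotZr => /predU1P[->|iT]; first by rewrite mulrC subrr.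
    by rewrite (wT i) // (c0 i) // !mulr0 subrr.
  move=> jw; have := congr1 (dot q) jw.
  have qw : dot q w = 0 := bw None.
  rewrite dotBr !dotZr qw qc mulr0 mulr1 sub0r dot0r => /eqP.
  rewrite oppr_eq0 => /eqP jw0; move/eqP: jw.
  by rewrite jw0 scale0r subr0 scaler_eq0 gt_eqF ?cp //= => /eqP.
have [|u bu xE] := dual_basis _ b0; first by rewrite card_option card_sig -cT.
have uN : u None = c.
  apply/eqP; rewrite -subr_eq0; apply/eqP/b0 => k.
  rewrite dotBr bu; case: k => [[k kT]|] /=; first by rewrite c0 // subr0.
  by rewrite qc subrr.
pose v j := oapp (fun k => u (Some k)) 0 (insub j).
have vE (k : {j | j \in T}) : v (val k) = u (Some k) by rewrite /v valK.
have xvE x : x = \sum_(a in T) dot x (v a) *: p a + dot x (u None) *: q.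
  rewrite {1}[x]xE (bigD1 None) //= addrC (reindex_omap Some id) /=; last by case.
  rewrite (eq_bigl xpredT) => [|k]; last by rewrite /= eqxx.
  by rewrite [in RHS]big_sub; congr (_ + _); apply: eq_bigr => k _; rewrite vE.
exists v; split=> //; last by rewrite -uN.
- by move=> a aT; rewrite (vE (exist _ a aT)); exact: (bu None).
- move=> k a kT aT; rewrite (vE (exist _ a aT)).
  by rewrite (bu (Some (exist _ k kT)) (Some (exist _ a aT))).
Qed.

Definition facet T : bool := (#|T| == d) && `[< cone_face T >].

Lemma facetP T : reflect (cone_face T /\ #|T| = d) (facet T).
Proof.
by apply: (iffP andP) => [[/eqP ? /asboolP ?]|[? ->]]; split=> //; exact/asboolP.
Qed.

(** Both functionals have the same values on the basis of the frame. *)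
Lemma frame_pivot c u T a b c' : frame c u T -> a \in T ->
  exposes c' (b |: T :\ a) -> c' = c + dot (p a) c' *: u a.
Proof.
move=> [_ _ _ xE] aT [qc' c'0 _]; apply/eqP; rewrite -subr_eq0; apply/eqP.
apply: dot_inj => x; apply/eqP; rewrite dotBr subr_eq0 {1}[x]xE dotDl dot_suml.
rewrite (bigD1 a) //= big1 => [|k /andP[kT ka]].
  by rewrite addr0 !dotZl qc' mulr1 addrC dotDr dotZr mulrC.
by rewrite dotZl c'0 ?mulr0 // !inE ka kT orbT.
Qed.

(** The pivot of the simplex method: tilting along u a makes the vector a slack
    and keeps the rest of T tight, and general position allows just one new tight
    vector b. *)
Lemma exists_pivot c u T a : frame c u T -> #|T| = d -> a \in T ->
  exists2 b, b \notin T & exists2 c', exposes c' (b |: T :\ a)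
    & exists2 t, 0 < t & c' = c + t *: u a.
Proof.
move=> [eT qu pu _] cT aT; have [qc c0 cp] := eT.
have uT j : j \in T -> 0 <= dot (p j) (u a) by move=> jT; rewrite pu // ler0n.
have [|t [S t0 [eS [b ub bS]]]] := cone_face_rotate eT uT (qu a aT).
  by exists a; rewrite pu // eqxx oner_neq0.
have bT : b \notin T by apply: contraTN ub => /uT; rewrite -leNgt.
have sub : b |: T :\ a \subset S.
  apply/subsetP=> j; rewrite !inE => /predU1P[->//|/andP[ja jT]].
  have [_ _ pS] := eS; apply: contraT => /pS.
  by rewrite dotDr dotZr c0 // pu // (negPf ja) mulr0 addr0 ltxx.
have ES : b |: T :\ a = S.
  apply/eqP; rewrite eqEcard sub (leq_trans (card_cone_face _)) //.
    by exists (c + t *: u a).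
  by rewrite cardsU1 !inE (negPf bT) andbF -cT (cardsD1 a T) aT.
by exists b => //; exists (c + t *: u a); rewrite ?ES //; exists t.
Qed.

(** The functionals of both facets lie on the line through c in the direction
    u a, at times that solve the same ratio test. *)
Lemma pivot_uniq T a b b' : facet T -> a \in T -> b \notin T -> b' \notin T ->
  cone_face (b |: T :\ a) -> cone_face (b' |: T :\ a) -> b = b'.
Proof.
move=> /facetP[[c eT] cT] aT bT b'T [w ew] [w' ew'].
have [u fu] := exists_frame eT cT.
have [_ _ cp] := eT.
have pivot e v : e \notin T -> exposes v (e |: T :\ a) ->
    (forall j, 0 <= dot (p j) c + dot (p a) v * dot (p j) (u a)) /\
    exists2 j, dot (p j) (u a) < 0 & dot (p j) c + dot (p a) v * dot (p j) (u a) = 0.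
  move=> eNT ev; have vE := frame_pivot fu aT ev.
  have H j : dot (p j) c + dot (p a) v * dot (p j) (u a) = dot (p j) v.
    by rewrite {2}vE dotDr dotZr.
  split=> [j|]; first by rewrite H (exposes_ge0 _ ev).
  have e0 : dot (p e) c + dot (p a) v * dot (p e) (u a) = 0.
    by rewrite H; case: ev => _ -> //; rewrite !inE eqxx.
  exists e => //; rewrite ltNge; apply/negP => ue0.
  have := cp e eNT; rewrite ltNge; apply/negP; rewrite negbK -e0.
  by rewrite lerDl mulr_ge0 // (exposes_ge0 _ ev).
have [w0 wz] := pivot _ _ bT ew; have [w'0 w'z] := pivot _ _ b'T ew'.
have aww' := ratio_test_uniq w0 wz w'0 w'z.
have {}aww' : w = w'.
  by rewrite (frame_pivot fu aT ew) aww' -(frame_pivot fu aT ew').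
move: ew; rewrite aww' => /exposes_inj /(_ ew') /setP /(_ b).
rewrite !inE eqxx /= (negPf bT) andbF orbF.
by move/esym/eqP.
Qed.

(** Besides one facet T over the ridge S there is the pivot of T at the vector
    that is not in S, and any further facet would be another such pivot. *)
Lemma card_facets_ridge S : cone_face S -> #|S|.+1 = d ->
  #|[set T | facet T & S \subset T]| = 2%N.
Proof.
move=> fS cS; have [T fT [ST cT]] := exists_cone_facet fS.
have facetT : facet T by apply/facetP.
have /subsetPn[a aT aS] : ~~ (T \subset S).
  by apply: contraTN isT => /subset_leq_card; rewrite cT -cS ltnn.
have ET : T :\ a = S.
  apply/esym/eqP; rewrite eqEcard subsetD1 ST aS /= -ltnS cS -cT.
  by rewrite (cardsD1 a T) aT.
have [c eT] := fT; have [u fu] := exists_frame eT cT.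
have [b bT [c' ec' _]] := exists_pivot fu cT aT.
have bS : b \notin S by apply: contraNN bT; move/(subsetP ST).
have <- : #|[set T; b |: S]| = 2%N.
  by rewrite cards2 (_ : T != b |: S) //; apply: contraNneq bT => ->; rewrite !inE eqxx.
congr #|pred_of_set _|; apply/setP=> T'; rewrite !inE.
apply/andP/orP => [[/facetP[fT' cT'] ST']|].
  have /subsetPn[e eT' eS] : ~~ (T' \subset S).
    by apply: contraTN isT => /subset_leq_card; rewrite cT' -cS ltnn.
  have ET' : e |: S = T'.
    by apply/eqP; rewrite eqEcard subUset sub1set eT' ST' cardsU1 eS cT' -cS leqnn.
  have [eT1|eT1] := boolP (e \in T).
    by left; rewrite -ET' eqEcard subUset sub1set eT1 ST cardsU1 eS cT -cS leqnn.
  right; rewrite -ET'; apply/eqP; congr (_ |: _).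
  by apply: (pivot_uniq facetT aT eT1 bT); rewrite ET ?ET' // -ET; exists c'.
case=> /eqP ->; first by [].
split; last exact: subsetUr.
apply/facetP; split; first by rewrite -ET; exists c'.
by rewrite cardsU1 bS add1n.
Qed.

Lemma exists_frames : exists C U, forall T, facet T -> frame (C T) (U T) T.
Proof.
have /choice [f fP] T : exists cu, facet T -> frame cu.1 cu.2 T.
  have [/facetP[[c eT] cT]|_] := boolP (facet T); last by exists (0, fun=> 0).
  by have [u fu] := exists_frame eT cT; exists (c, u).
by exists (fun T => (f T).1), (fun T => (f T).2).
Qed.

Variables (C : {set J} -> 'cV[R]_d.+1) (U : {set J} -> J -> 'cV[R]_d.+1).
Hypothesis frameT : forall T, facet T -> frame (C T) (U T) T.
Variable g : 'rV[R]_d.+1.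

(** At the vertex T of the slice, the linear form g increases along all edges
    that stay in the face of the functionals vanishing on S. *)
Definition positive_outside S T : bool :=
  [&& facet T, S \subset T & [forall a in T :\: S, 0 < dot g (U T a)]].

(** Expand g in the frame of T. Its value at the functional of T' exceeds its
    value at that of T by a sum of nonnegative terms, and they all vanish only if
    the functional of T' vanishes on T. *)
Lemma positive_outside_min S T T' : positive_outside S T ->
  facet T' -> S \subset T' ->
  dot g (C T) <= dot g (C T') ?= iff (T == T').
Proof.
move=> /and3P[fT ST /forall_inP pos] fT' ST'.
have [eT _ _ xE] := frameT fT; have [eT' _ _ _] := frameT fT'.
have -> : dot g (C T') = \sum_(a in T) dot g (U T a) * dot (p a) (C T') + dot g (C T).
  rewrite [g in LHS]xE dotDl dot_suml dotZl; case: (eT') => -> _ _; rewrite mulr1.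
  by congr (_ + _); apply: eq_bigr => a _; rewrite dotZl.
have term0 a : a \in T -> 0 <= dot g (U T a) * dot (p a) (C T').
  move=> aT; have [aS|aS] := boolP (a \in S).
    by case: eT' => _ -> //; rewrite ?mulr0 // (subsetP ST').
  by rewrite mulr_ge0 ?(exposes_ge0 _ eT') // ltW // pos // inE aS.
apply/leifP; case: eqVneq => [TT'|TT'].
  rewrite big1 ?add0r // => a aT.
  by case: eT' => _ -> //; rewrite ?mulr0 // -TT'.
rewrite ltrDr lt_neqAle sumr_ge0 // andbT eq_sym; apply: contra TT' => /eqP s0.
have [/facetP[_ cT] /facetP[_ cT']] := conj fT fT'.
rewrite eqEcard cT cT' leqnn andbT; apply/subsetP=> a aT.
have [|aS] := boolP (a \in S); first exact/subsetP.
have /eqP := psumr_eq0P term0 s0 aT.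
rewrite mulf_eq0 gt_eqF ?pos ?inE ?aS //= => /eqP a0.
by apply: contraT => aT'; case: eT' => _ _ /(_ a aT'); rewrite a0 ltxx.
Qed.

Hypothesis generic_g : forall T a, facet T -> a \in T -> dot g (U T a) != 0.

(** Existence is the simplex method: where g is minimal among the facets over
    S, a negative coordinate would allow a pivot that decreases g. Uniqueness is
    the equality case of [positive_outside_min]. *)
Lemma card_positive_outside S : cone_face S ->
  #|[set T | positive_outside S T]| = 1%N.
Proof.
move=> fS; have [T0 fT0 [ST0 cT0]] := exists_cone_facet fS.
have T0P : facet T0 && (S \subset T0) by rewrite ST0 andbT; apply/facetP.
have [T /andP[fT ST] minT] :=
  @arg_minP _ _ _ T0 (fun T => facet T && (S \subset T)) (fun T => dot g (C T)) T0P.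
have posT : positive_outside S T.
  apply/and3P; split=> //; apply/forall_inP => a /setDP[aT aS].
  rewrite lt_neqAle eq_sym generic_g //= leNgt; apply/negP => neg.
  have /facetP[_ cT] := fT.
  have [b bT [c' ec' _]] := exists_pivot (frameT fT) cT aT.
  have fT' : facet (b |: T :\ a).
    apply/facetP; split; first by exists c'.
    by rewrite cardsU1 !inE (negPf bT) andbF -cT (cardsD1 a T) aT.
  have [eT' _ _ _] := frameT fT'.
  have := minT (b |: T :\ a).
  rewrite fT' (frame_pivot (frameT fT) aT eT') dotDr dotZr leNgt => /(_ _)/negP; apply.
    apply/subsetP=> j jS; rewrite !inE (subsetP ST) // andbT.
    by rewrite (contraTneq _ jS) ?orbT // => ->.
  rewrite gtrDl pmulr_rlt0 //; case: eT' => _ _; apply.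
  by rewrite !inE eqxx orbF; apply: contraNneq bT => <-.
apply/eqP/cards1P; exists T; apply/setP=> T'; rewrite !inE.
apply/idP/eqP => [posT'|->//].
have /and3P[fT' ST' _] := posT'.
have [le1 eq1] := positive_outside_min posT fT' ST'.
have [le2 _] := positive_outside_min posT' fT ST.
by apply/esym/eqP; rewrite -eq1 eq_le le1 le2.
Qed.

End Configuration.

(** A constant sign pattern contributes 3 to both sides, any other pattern
    contributes 1. *)
Lemma sum_signs (J : finType) (T : {set J}) (f : pred J) : #|T| = 3%N ->
  (\sum_(j in T) [forall a in T :\ j, f a]
    + \sum_(j in T) [forall a in T :\ j, ~~ f a]
   = 1 + 2 * [forall a in T, f a] + 2 * [forall a in T, ~~ f a])%N.
Proof.
have allE (P Q : pred J) :
    [forall (a | (a \in T) && P a), Q a] = all (fun a => P a ==> Q a) (enum T).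
  apply/forall_inP/allP => [H a|H a /andP[aT Pa]].
    by rewrite mem_enum => aT; apply/implyP => Pa; rewrite H ?aT.
  by have := H a; rewrite mem_enum Pa; apply.
have allD j h : [forall a in T :\ j, h a] = all (fun a => (a != j) ==> h a) (enum T).
  by rewrite -allE; apply: eq_forallb => a; rewrite !inE andbC.
have allT h : [forall a in T, h a] = all h (enum T).
  have -> : all h (enum T) = all (fun a => true ==> h a) (enum T) by apply: eq_all.
  by rewrite -allE; apply: eq_forallb => a; rewrite andbT.
rewrite !allT; under eq_bigr do rewrite allD.
under [X in (_ + X)%N]eq_bigr do rewrite allD.
rewrite -!big_enum cardE; have := enum_uniq (mem T).
case: (enum T) => [|a [|b [|c [|? ?]]]] //=.
rewrite !inE negb_or !andbT => /andP[/andP[ab ac] bc] _.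
rewrite !big_cons !big_nil /= !eqxx /= ab ac bc ![_ == a]eq_sym [c == b]eq_sym.
rewrite (negPf ab) (negPf ac) (negPf bc) /=.
by case: (f a) (f b) (f c) => [] [] [].
Qed.

(** Sum [sum_signs] over all facets, for the signs of the coordinates of a
    generic g. Through each vector j there is one facet whose other two coordinates
    are positive, and one whose other two are negative; this gives 2 #|J| on the
    left. On the right, one facet is positive and one is negative throughout. *)
Theorem card_facets_dim3 (R : realFieldType) (J : finType) (p : J -> 'rV[R]_4) :
  general_position p -> (3 < #|J|)%N -> cone_face p set0 ->
  (forall j, cone_face p [set j]) ->
  (#|[set T | facet p T]| + 4 = 2 * #|J|)%N.
Proof.
move=> gp ltJ f0 f1; have [C [U CU]] := exists_frames gp ltJ.
have [g gP] := generic_vector (fun Ta : {set J} * J => U Ta.1 Ta.2).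
have {}gP T a : facet p T -> a \in T -> dot g (U T a) != 0.
  move=> fT aT; apply: (gP (T, a)); apply: contraTneq isT => /= u0.
  case: (CU T fT) => _ _ /(_ a a aT aT) /eqP.
  by rewrite eqxx u0 dot0r eq_sym oner_eq0.
have gN T a : facet p T -> a \in T -> dot (- g) (U T a) != 0.
  by move=> fT aT; rewrite dotNl oppr_eq0 gP.
have count h (hg : forall T a, facet p T -> a \in T -> dot h (U T a) != 0) :
    (\sum_(T | facet p T) [forall a in T, 0 < dot h (U T a)]%R = 1)%N /\
    (\sum_(T | facet p T) \sum_(j in T) [forall a in T :\ j, 0 < dot h (U T a)]%R
      = #|J|)%N.
  split.
    rewrite -[RHS](card_positive_outside gp ltJ CU hg f0) -sum1_card big_mkcond.
    rewrite [RHS]big_mkcond /=; apply: eq_bigr => T _.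
    by rewrite inE /positive_outside sub0set setD0; case: facet => //=; case: ifP.
  rewrite -sum1_card (exchange_big_dep predT) //=; apply: eq_bigr => j _.
  rewrite -[RHS](card_positive_outside gp ltJ CU hg (f1 j)) -sum1_card big_mkcond.
  rewrite [RHS]big_mkcond /=; apply: eq_bigr => T _.
  rewrite inE /positive_outside sub1set; case: facet => //=.
  by case: (j \in T) => //=; case: ifP.
have [g1 gJ] := count g gP; have [n1 nJ] := count (- g) gN.
have signE (T S : {set J}) : facet p T -> S \subset T ->
    [forall a in S, 0 < dot (- g) (U T a)] = [forall a in S, ~~ (0 < dot g (U T a))].
  move=> fT ST; apply: eq_forallb => a; have [aS|//] := boolP (a \in S).
  by rewrite /= dotNl oppr_gt0 -leNgt le_eqVlt (negPf (gP T a fT (subsetP ST _ aS))).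
rewrite mul2n -addnn -{1}gJ -nJ -big_split /=.
rewrite (eq_bigr (fun T : {set J} => 1 + 2 * [forall a in T, 0 < dot g (U T a)]%R
   + 2 * [forall a in T, 0 < dot (- g) (U T a)]%R))%N => [|T fT]; last first.
  have /facetP[_ cT] := fT.
  rewrite signE // -sum_signs //; congr (_ + _)%N.
  by apply: eq_bigr => j _; rewrite signE // subsetDl.
by rewrite !big_split /= g1 n1 !big1_eq sum1dep_card -addnA.
Qed.

(** * Counting faces of a product of polygons from the vertices *)

Local Open Scope nat_scope.

Section PolygonProduct.
Variables (T : finType) (le : rel T) (vt : pred T) (top : T) (star : T -> bool -> T).
Variables (n r : nat).

Definition is_edge x := ~~ vt x && (x != top).

(** What the counting uses of the nonempty faces of an n-gon: the vertices are
    marked by [vt], and the two edges at the vertex v are [star v false] and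
    [star v true]. *)
Record polygon_lattice : Prop := PolygonLattice {
  lattice_le_top : forall x, le x top;
  lattice_le_vt : forall v w, vt v -> vt w -> le w v = (w == v);
  lattice_vt_top : ~~ vt top;
  lattice_card_vt : #|[pred v | vt v]| = n;
  lattice_card_edge : forall x, is_edge x -> #|[pred v | vt v && le v x]| = 2;
  lattice_star_edge : forall v b, vt v -> is_edge (star v b);
  lattice_star_le : forall v b, vt v -> le v (star v b);
  lattice_star_neq : forall v, vt v -> star v false != star v true;
  lattice_above : forall v x, vt v -> le v x ->
    [\/ x = v, (exists b, x = star v b) | x = top]
}.

Hypothesis lat : polygon_lattice.

Notation G := {ffun 'I_r -> T}.
Notation J := ('I_r * bool)%type.
Implicit Types (g v : G) (S : {set J}).

Definition vertices_of g : {set G} := [set v : G | [forall i, vt (v i) && le (v i) (g i)]].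
Definition all_vt v := [forall i, vt (v i)].
Definition num_top g := #|[set i | g i == top]|.
Definition num_edge g := #|[set i | is_edge (g i)]|.

Definition num_both S := #|[set i | ((i, false) \in S) && ((i, true) \in S)]|.
Definition num_single S := #|[set i | ((i, false) \in S) (+) ((i, true) \in S)]|.

(** The face of the product spanned by the edges in S at the vertex v. The pair
    (i, b) stands for the edge that moves the component i along [star (v i) b]. *)
Definition join_edges v S : G :=
  [ffun i => if (i, false) \in S
             then if (i, true) \in S then top else star (v i) false
             else if (i, true) \in S then star (v i) true else v i].

Lemma card_num S : #|S| = num_single S + (num_both S).*2.
Proof.
have cardE (I : finType) (A : {set I}) : #|A| = \sum_i (i \in A).
  by rewrite -sum1_card big_mkcond; apply: eq_bigr => i _; case: ifP.
rewrite /num_single /num_both -addnn !cardE -!big_split /=.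
rewrite (eq_bigr (fun j : J => ((j.1, j.2) \in S : nat))) => [|[i b] //].
rewrite -(pair_big predT predT (fun i b => ((i, b) \in S : nat))) /=.
apply: eq_bigr => i _; rewrite !inE big_bool /=.
by case: (_ \in S); case: (_ \in S).
Qed.

Lemma card_all_vt : #|[set v | all_vt v]| = n ^ r.
Proof.
rewrite -(lattice_card_vt lat) -[X in _ ^ X]card_ord -card_ffun_on cardsE.
by apply: eq_card => v; rewrite inE; apply: eq_forallb => i.
Qed.

(** The vertices are chosen component by component: n choices in a polygon, two
    in an edge. *)
Lemma card_vertices_of g : #|vertices_of g| = n ^ num_top g * 2 ^ num_edge g.
Proof.
have -> : #|vertices_of g| = #|family (fun i => [pred w | vt w && le w (g i)])|.
  by rewrite cardsE; apply: eq_card.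
rewrite card_family foldrE big_map big_enum /= -!prod_nat_const.
rewrite [X in X * _]big_mkcond [X in _ * X]big_mkcond -big_split /=.
apply: eq_bigr => i _; rewrite !inE /is_edge.
case: eqVneq => [->|gi] /=.
  rewrite andbF muln1 -(lattice_card_vt lat); apply: eq_card => w.
  by rewrite !unfold_in /= (lattice_le_top lat) andbT.
rewrite andbT mul1n; have [vg|vg] /= := boolP (vt (g i)); last first.
  by rewrite (lattice_card_edge lat) // /is_edge vg.
rewrite -[RHS](card1 (g i)); apply: eq_card => w; rewrite !unfold_in /=.
have [vw|] := boolP (vt w); first by rewrite (lattice_le_vt lat).
by move=> vw; apply/esym; apply: contraNF vw => /eqP ->.
Qed.

Variable v : G.
Hypothesis vtv : all_vt v.

Let vtvi i : vt (v i). Proof. exact: (forallP vtv). Qed.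

Let star_top i b : (star (v i) b == top) = false.
Proof. by apply/negbTE; have /andP[] := lattice_star_edge lat b (vtvi i). Qed.

Let star_vt i b : vt (star (v i) b) = false.
Proof. by apply/negbTE; have /andP[] := lattice_star_edge lat b (vtvi i). Qed.

Let star_v i b : (star (v i) b == v i) = false.
Proof. by apply: contraTF (vtvi i) => /eqP <-; rewrite star_vt. Qed.

Let v_top i : (v i == top) = false.
Proof. by apply: contraTF (vtvi i) => /eqP ->; rewrite (lattice_vt_top lat). Qed.

Let star_neq i : (star (v i) false == star (v i) true) = false.
Proof. by apply/negbTE/(lattice_star_neq lat). Qed.

Lemma mem_join_edges S i b :
  ((i, b) \in S) = (join_edges v S i == star (v i) b) || (join_edges v S i == top).
Proof.
rewrite ffunE; case: b; case: (_ \in S); case: (_ \in S) => /=;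
  by rewrite ?eqxx ?orbT // ?star_neq ?star_top ?v_top ?[v i == _]eq_sym ?star_v
    ?[star _ true == _]eq_sym ?star_neq.
Qed.

Lemma join_edges_inj : injective (join_edges v).
Proof. by move=> S S' e; apply/setP => -[i b]; rewrite !mem_join_edges e. Qed.

Lemma le_join_edges S i : le (v i) (join_edges v S i).
Proof.
rewrite ffunE; case: ifP => _; case: ifP => _;
  by rewrite ?(lattice_le_top lat) ?(lattice_star_le lat) // (lattice_le_vt lat).
Qed.

Lemma join_edges_onto g : (forall i, le (v i) (g i)) -> exists S, g = join_edges v S.
Proof.
move=> vg; exists [set j : J | (g j.1 == star (v j.1) j.2) || (g j.1 == top)].
apply/ffunP => i; rewrite ffunE !inE /=.
have [->|[b ->]|->] := lattice_above lat (vtvi i) (vg i).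
- by rewrite ![v i == star _ _]eq_sym !star_v v_top.
- rewrite star_top !orbF; case: b; rewrite ?eqxx ?star_neq //.
  by rewrite eq_sym star_neq.
- by rewrite eqxx !orbT.
Qed.

Lemma num_top_join S : num_top (join_edges v S) = num_both S.
Proof.
apply: eq_card => i; rewrite !inE ffunE.
by case: (_ \in S); case: (_ \in S); rewrite /= ?eqxx ?star_top ?v_top.
Qed.

Lemma num_edge_join S : num_edge (join_edges v S) = num_single S.
Proof.
apply: eq_card => i; rewrite !inE ffunE /is_edge.
case: (_ \in S); case: (_ \in S) => /=;
  by rewrite ?eqxx ?andbF ?star_top ?star_vt ?vtvi.
Qed.

End PolygonProduct.

(** Count the pairs of a vertex and a face through it. A face has
    n ^ a * 2 ^ b vertices, and the faces through v correspond to the sets of edges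
    at v. *)
Theorem double_count (T : finType) (le : rel T) (vt : pred T) (top : T)
    (star : T -> bool -> T) (n r : nat) (Phi : pred {ffun 'I_r -> T}) (a b k : nat) :
  polygon_lattice le vt top star n ->
  (forall g, Phi g -> num_top top g = a /\ num_edge vt top g = b) ->
  (forall v, all_vt vt v -> #|[set S | Phi (join_edges top star v S)]| = k) ->
  n ^ a * 2 ^ b * #|[set g | Phi g]| = n ^ r * k.
Proof.
move=> lat ab local; rewrite mulnC -sum_nat_const.
rewrite (eq_bigr (fun g => \sum_(v in vertices_of le vt g) 1)) => [|g]; last first.
  by rewrite inE => /ab[ga gb]; rewrite sum1_card (card_vertices_of lat) ga gb.
rewrite (exchange_big_dep (@all_vt T vt r)) /= => [|g v _]; last first.
  by rewrite inE => /forallP vg; apply/forallP => i; case/andP: (vg i).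
rewrite -(card_all_vt r lat) -sum_nat_const; under [RHS]eq_bigl do rewrite inE.
apply: eq_bigr => v vtv; rewrite -(local v vtv) sum1_card.
rewrite -(card_imset _ (join_edges_inj lat vtv)); apply: eq_card => g.
rewrite [LHS]unfold_in /= !inE; apply/andP/imsetP => [[Pg /forallP vg]|[S]].
  have [S gS] := join_edges_onto lat vtv (fun i => proj2 (andP (vg i))).
  by exists S => //; rewrite inE -gS.
rewrite inE => PS ->; split=> //; apply/forallP => i.
by rewrite (forallP vtv) (le_join_edges lat).
Qed.

Local Open Scope ring_scope.

(** * The faces at one vertex *)

(** The midpoint of two exposing functionals exposes the intersection. *)
Lemma cone_face_setI (R : realFieldType) (J : finType) d (p : J -> 'rV[R]_d.+1)
    (S S' : {set J}) : cone_face p S -> cone_face p S' -> cone_face p (S :&: S').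
Proof.
move=> [c ec] [c' ec']; have [qc c0 cp] := ec; have [qc' c0' cp'] := ec'.
exists (2^-1 *: (c + c')); split=> [|j|j].
- by rewrite dotZr dotDr qc qc' -mulr2n mulVf // pnatr_eq0.
- by move=> /setIP[/c0 jc /c0' jc']; rewrite dotZr dotDr jc jc' addr0 mulr0.
- rewrite inE negb_and dotZr dotDr => jS; apply: mulr_gt0; first by rewrite invr_gt0.
  have [cj c'j] := (exposes_ge0 j ec, exposes_ge0 j ec').
  by case/orP: jS => [/cp|/cp'] h; [apply: ltr_wpDr|apply: ltr_wpDl].
Qed.

Section PairedConfiguration.
Variables (R : realFieldType) (r : nat) (p : 'I_r * bool -> 'rV[R]_4).
Notation J := ('I_r * bool)%type.
Implicit Types (S T : {set J}) (i : 'I_r).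
Local Open Scope nat_scope.

Hypotheses (gp : general_position p) (r2 : 1 < r).

(** The two edges at a vertex that span the polygon in the component i. *)
Definition edge_pair i : {set J} := [set (i, false); (i, true)].

Hypothesis face0 : cone_face p set0.
Hypothesis face1 : forall j, cone_face p [set j].
Hypothesis face_pair : forall i, cone_face p (edge_pair i).

(** The surviving faces at a vertex that are products of a polygons and b edges. *)
Definition local_count a b :=
  #|[set S | [&& `[< cone_face p S >], num_both S == a & num_single S == b]]|.

Let ltJ : 3 < #|{: J}|.
Proof. by rewrite card_prod card_ord card_bool; lia. Qed.

Lemma card_facets : #|[set T | facet p T]| + 4 = 4 * r.
Proof.
by rewrite (card_facets_dim3 gp ltJ face0 face1) card_prod card_ord card_bool; lia.
Qed.

(** T without a is the intersection of T with its pivot at a. *)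
Lemma facetD1 T a : facet p T -> a \in T -> cone_face p (T :\ a).
Proof.
move=> /facetP[[c eT] cT] aT; have [u fu] := exists_frame gp ltJ eT cT.
have [b bT [c' ec' _]] := exists_pivot gp fu cT aT.
have ab : a != b by apply: contraNneq bT => <-.
have -> : T :\ a = T :&: (b |: T :\ a).
  apply/setP => j; rewrite !inE; case: eqVneq => [->|_] /=.
    by rewrite (negPf ab) andbF.
  by case: (j \in T) => //=; rewrite orbT.
by apply: cone_face_setI; [exists c|exists c'].
Qed.

Lemma card_facets_over S : cone_face p S -> #|S| = 2 ->
  \sum_(T | facet p T && (S \subset T)) 1 = 2.
Proof. by move=> fS cS; rewrite sum1dep_card (card_facets_ridge gp ltJ) // cS. Qed.

(** Count the incident pairs: a ridge lies in two facets, a facet contains three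
    ridges. *)
Lemma card_ridges :
  #|[set S | `[< cone_face p S >] && (#|S| == 2)]| * 2 = #|[set T | facet p T]| * 3.
Proof.
rewrite -!sum_nat_const.
rewrite (eq_bigr (fun S => \sum_(T | facet p T && (S \subset T)) 1)) => [|S]; last first.
  by rewrite inE => /andP[/asboolP fS /eqP cS]; rewrite card_facets_over.
rewrite (exchange_big_dep (facet p)) /= => [|S T _ /andP[]//].
rewrite [RHS](eq_bigl (facet p)) => [|T]; last by rewrite inE.
apply: eq_bigr => T fT; rewrite sum1dep_card; have /facetP[_ cT] := fT.
have Tinj : {in T &, injective (fun a => T :\ a)}.
  move=> a b aT bT /setP/(_ b); rewrite !inE eqxx bT /= andbT.
  by case: eqVneq => [->|].
rewrite -[RHS]cT -(card_in_imset Tinj); apply: eq_card => S; rewrite !inE.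
apply/andP/imsetP => [[/andP[_ /eqP cS] /andP[_ ST]]|[a aT ->]].
  have /eqP/cards1P[a TSa] : #|T :\: S| = 1.
    by have := cardsID S T; rewrite (setIidPr ST) cS cT => -[].
  have /setDP[aT aS] : a \in T :\: S by rewrite TSa set11.
  by exists a => //; rewrite -TSa setDDr setDv set0U (setIidPr ST).
rewrite fT subD1set; split=> //; apply/andP; split; first by apply/asboolP/facetD1.
by have := cardsD1 a T; rewrite aT cT => -[] /esym/eqP.
Qed.

Lemma num_pair S i : #|S| < 4 -> edge_pair i \subset S -> num_both S = 1.
Proof.
move=> cS iS; have := card_num S; have: 0 < num_both S.
  apply/card_gt0P; exists i; rewrite inE.
  by rewrite !(subsetP iS) // !inE eqxx ?orbT.
by move: cS; lia.
Qed.

Lemma num_bothP S : 0 < num_both S -> exists i, edge_pair i \subset S.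
Proof.
case/card_gt0P => i; rewrite inE => /andP[i0 i1]; exists i.
by apply/subsetP => j; rewrite !inE => /orP[] /eqP ->.
Qed.

Lemma pair_uniq S i i' : #|S| < 4 -> edge_pair i \subset S -> edge_pair i' \subset S -> i = i'.
Proof.
move=> cS iS i'S; have /eqP/cards1P[k /setP kE] := num_pair cS iS.
have inS o : edge_pair o \subset S -> o = k.
  move=> oS; have := kE o; rewrite !inE !(subsetP oS) ?inE ?eqxx ?orbT //.
  by move=> /esym/eqP.
by rewrite (inS i) // (inS i').
Qed.

Lemma card_pair i : #|edge_pair i| = 2.
Proof. by rewrite cards2 xpair_eqE andbF. Qed.

Lemma local_count00 : local_count 0 0 = 1.
Proof.
apply/eqP/cards1P; exists set0; apply/setP => S; rewrite !inE.
apply/and3P/eqP => [[_ /eqP b0 /eqP s0]|->].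
  by apply/eqP; rewrite -cards_eq0 card_num b0 s0.
by split; [exact/asboolP| |]; rewrite /num_both /num_single -leqn0 leqNgt;
  apply/card_gt0P => -[i]; rewrite !inE.
Qed.

Lemma local_count01 : local_count 0 1 = 2 * r.
Proof.
have -> : 2 * r = #|[set: J]| by rewrite cardsT card_prod card_ord card_bool mulnC.
rewrite -(card_imset _ (@set1_inj J)); apply: eq_card => S; rewrite !inE.
apply/and3P/imsetP => [[_ /eqP b0 /eqP s1]|[j _ ->]].
  have /eqP/cards1P[j ->] : #|S| = 1 by rewrite card_num b0 s1.
  by exists j.
have := card_num [set j]; rewrite cards1 => c1.
by split; [exact/asboolP|apply/eqP; lia|apply/eqP; lia].
Qed.

Lemma local_count10 : local_count 1 0 = r.
Proof.
have pair_inj : injective edge_pair.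
  by move=> i i' ii'; apply: (@pair_uniq (edge_pair i')); rewrite ?card_pair // ii'.
rewrite -[RHS]card_ord -cardsT -(card_imset _ pair_inj); apply: eq_card => S.
rewrite !inE; apply/and3P/imsetP => [[_ /eqP b1 /eqP s0]|[i _ ->]].
  have [|i iS] := @num_bothP S; first by rewrite b1.
  by exists i => //; apply/esym/eqP; rewrite eqEcard iS card_num b1 s0 card_pair.
have := card_num (edge_pair i); rewrite (@num_pair _ i) ?card_pair // => c1.
by split; [exact/asboolP| |apply/eqP; lia].
Qed.

Lemma card_local a b k : b + a.*2 = k -> local_count a b =
  #|[set S | `[< cone_face p S >] && (#|S| == k)] :&: [set S | num_both S == a]|.
Proof.
move=> <-; apply: eq_card => S; rewrite !inE -andbA; congr (_ && _).
by rewrite card_num [RHS]andbC; case: eqVneq => //= ->; rewrite eqn_add2r.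
Qed.

Lemma local_count02 : local_count 0 2 + 6 = 5 * r.
Proof.
have := cardsID [set S | num_both S == 0] [set S | `[< cone_face p S >] && (#|S| == 2)].
have := card_ridges; have := card_facets; have := local_count10.
rewrite !(@card_local _ _ 2) //; set A := [set S | _ && _].
have -> : A :\: [set S | num_both S == 0] = A :&: [set S | num_both S == 1].
  apply/setP => S; rewrite !inE; case: asboolP => //= _; rewrite ?andbF //.
  case: (#|S| =P 2) => [cS|_]; rewrite ?andbF //; have := card_num S; rewrite cS.
  by case: (num_both S) => [|[|b]] //; lia.
clear; move: #|A| #|[set T | facet p T]| #|A :&: [set S | num_both S == 1]|
  #|A :&: [set S | num_both S == 0]| => k f x y; lia.
Qed.

(** These are the facets that contain a pair; a set of three edges contains at
    most one, and there are two facets over each. *)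
Lemma local_count11 : local_count 1 1 = 2 * r.
Proof.
rewrite (@card_local _ _ 3) // -sum1_card.
rewrite (eq_bigr (fun T => \sum_(i | edge_pair i \subset T) 1)) => [|T]; last first.
  rewrite !inE => /andP[/andP[_ /eqP cT] /eqP b1].
  have [|i iT] := @num_bothP T; first by rewrite b1.
  rewrite (big_pred1 i) // => i'; apply/idP/eqP => [i'T|->//].
  by apply: pair_uniq i'T iT; rewrite cT.
rewrite (exchange_big_dep predT) //= mulnC -[X in _ = X * _]card_ord -sum_nat_const.
apply: eq_bigr => i _; rewrite -[RHS](card_facets_over (face_pair i) (card_pair i)).
apply: eq_bigl => T; rewrite !inE /facet.
apply/andP/andP => [[/andP[/andP[fT cT] _] iT]|[/andP[cT fT] iT]].
  by rewrite iT; split=> //; apply/andP.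
rewrite iT fT cT (num_pair _ iT) //; move/eqP: cT => -> //.
Qed.

Lemma local_count03 : local_count 0 3 + 4 = 2 * r.
Proof.
have := cardsID [set S | num_both S == 0] [set S | `[< cone_face p S >] && (#|S| == 3)].
have := card_facets; have := local_count11.
rewrite !(@card_local _ _ 3) //; set A := [set S | _ && _].
have -> : A :\: [set S | num_both S == 0] = A :&: [set S | num_both S == 1].
  apply/setP => S; rewrite !inE; case: asboolP => //= _; rewrite ?andbF //.
  case: (#|S| =P 3) => [cS|_]; rewrite ?andbF //; have := card_num S; rewrite cS.
  by case: (num_both S) => [|[|b]] //; lia.
have -> : [set T | facet p T] = A by apply/setP => T; rewrite !inE andbC.
clear; move: #|A| #|A :&: [set S | num_both S == 1]|
  #|A :&: [set S | num_both S == 0]| => k x y; lia.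
Qed.

End PairedConfiguration.

(** * Dimension and faces of polytopes *)

From mathcomp Require Import classical_sets functions cardinality reals.

Local Open Scope classical_set_scope.
Local Open Scope ring_scope.

Section Dimension.
Variables (R : realType) (m : nat).
Implicit Types (S : set 'rV[R]_m) (x y : 'rV[R]_m).

(** The flat spanned by x and the points x + e k of S contains S. *)
Lemma has_dim_span S x (K : finType) (e : K -> 'rV[R]_m) :
  S x -> (forall k, S (x + e k)) ->
  (forall y, S y -> exists a : K -> R, y = x + \sum_k a k *: e k) ->
  has_dim S (\rank (\matrix_(k < #|K|) e (enum_val k))).
Proof.
move=> Sx Se Sspan; set D := \matrix_k _.
have spanD y : (y - x <= D)%MS <-> exists a : K -> R, y = x + \sum_k a k *: e k.
  split=> [/submxP[a yx]|[a ->]].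
    exists (fun k => a 0 (enum_rank k)); apply/eqP; rewrite addrC -subr_eq; apply/eqP.
    rewrite yx mulmx_sum_row (reindex enum_rank) /=; last exact/onW_bij/enum_rank_bij.
    by apply: eq_bigr => k _; rewrite rowK enum_rankK.
  rewrite addrC addKr; apply: summx_sub => k _; apply: scalemx_sub.
  by rewrite -[k]enum_rankK -(rowK (fun k => e (enum_val k))) row_sub.
exists x, <<D>>%MS; rewrite genmxE; split=> //; apply/seteqP; split=> y /=; rewrite genmxE.
  case=> s [v [a [vS a1 ->]]].
  rewrite -[x]scale1r -a1 scaler_suml -sumrB; apply: summx_sub => i _.
  by rewrite -scalerBr; apply: scalemx_sub; apply/spanD/Sspan.
move=> /spanD[a ->]; have [s sE] : exists s, s = \sum_k a k by eexists.
exists #|K|.+1, (fun i => oapp (fun j => x + e (enum_val j)) x (unlift ord0 i)),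
  (fun i => oapp (fun j => a (enum_val j)) (1 - s) (unlift ord0 i)).
split=> [i||]; first by case: unliftP => [j _|_] /=.
  rewrite big_ord_recl unlift_none; under eq_bigr do rewrite liftK.
  by rewrite /= -(big_enum_val _ (A := K)) -sE subrK.
rewrite big_ord_recl unlift_none; under [in RHS]eq_bigr do rewrite liftK.
rewrite /= -(big_enum_val (A := K) (fun k => a k *: (x + e k))) /=.
under [in RHS]eq_bigr do rewrite scalerDr.
by rewrite big_split /= -scaler_suml addrA -scalerDl -sE subrK scale1r.
Qed.

Lemma has_dim_uniq S d d' : has_dim S d -> has_dim S d' -> d = d'.
Proof.
suff le d1 d2 : has_dim S d1 -> has_dim S d2 -> (d1 <= d2)%N.
  by move=> Sd Sd'; apply/eqP; rewrite eqn_leq !le.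
move=> [x [D [<- SD]]] [x' [D' [<- SD']]]; apply/mxrankS/row_subP => i.
have inD y : (y - x <= D)%MS -> (y - x' <= D')%MS.
  by move=> yD; suff: affine_hull S y; [rewrite SD'|rewrite SD].
have -> : row i D = (x + row i D - x') - (x - x').
  by rewrite opprB addrA subrK addrC addKr.
apply: addmx_sub; last rewrite eqmx_opp; apply: inD; last by rewrite subrr sub0mx.
by rewrite addrC addKr row_sub.
Qed.

Lemma affine_hull_sub S : S `<=` affine_hull S.
Proof.
move=> x Sx; exists 1%N, (fun=> x), (fun=> 1).
by split=> //; rewrite big_ord1 // scale1r.
Qed.

Lemma has_dim_set1 x : has_dim [set x] 0.
Proof.
have /= := @has_dim_span [set x] x void (fun k => match k with end) erefl.
rewrite (_ : \rank _ = 0%N); first apply.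
- by case.
- by move=> y ->; exists (fun=> 0); rewrite big_pred0 ?addr0 // => -[].
- by apply/eqP; rewrite -leqn0 (leq_trans (rank_leq_row _)) // card_void.
Qed.

Lemma has_dim0P S : has_dim S 0 -> exists x, S = [set x].
Proof.
move=> [x [D [/eqP]]]; rewrite mxrank_eq0 => /eqP -> hS; exists x.
have Sx y : S y -> y = x.
  move=> /affine_hull_sub; rewrite hS /= submx0 subr_eq0 => /eqP //.
apply/seteqP; split=> [y /Sx //|_ ->].
have : affine_hull S x by rewrite hS /= subrr sub0mx.
case=> -[|k] [v [a [vS a1 _]]]; first by move: a1; rewrite big_ord0 => /eqP; rewrite eq_sym oner_eq0.
by rewrite -(Sx _ (vS ord0)); exact: vS.
Qed.

End Dimension.

Section VRepresentation.
Variables (R : realType) (m : nat).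
Implicit Types (P F V : set 'rV[R]_m) (c u : 'cV[R]_m) (b : R).

Lemma sub_convex_hull V : V `<=` convex_hull V.
Proof.
move=> x Vx; exists 1%N, (fun=> x), (fun=> 1).
by split=> //; rewrite big_ord1 ?scale1r.
Qed.

Lemma convex_hull_le V c b x : (forall v, V v -> dot v c <= b) ->
  convex_hull V x -> dot x c <= b.
Proof.
move=> Vc [k [v [a [vV a0 a1 ->]]]]; rewrite dot_suml -[b]mul1r -a1 mulr_suml.
by apply: ler_sum => i _; rewrite dotZl ler_wpM2l // Vc.
Qed.

(** In a convex combination at which c attains its bound, all points with a
    nonzero coefficient attain it too. *)
Lemma convex_hull_face V c b x : (forall v, V v -> dot v c <= b) ->
  convex_hull V x -> dot x c = b -> convex_hull (V `&` [set v | dot v c = b]) x.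
Proof.
move=> Vc [k [v [a [vV a0 a1 xE]]]] xb.
have tight i : a i != 0 -> dot (v i) c = b.
  move=> ai; have s0 : \sum_i a i * (b - dot (v i) c) = 0.
    under eq_bigr do rewrite mulrBr; rewrite sumrB -mulr_suml a1 mul1r -xb xE.
    by rewrite dot_suml; under eq_bigr do rewrite dotZl; rewrite subrr.
  have ge0 j : true -> 0 <= a j * (b - dot (v j) c).
    by move=> _; rewrite mulr_ge0 // subr_ge0 Vc.
  have /eqP := psumr_eq0P ge0 s0 (i := i) isT.
  by rewrite mulf_eq0 (negPf ai) subr_eq0 => /eqP <-.
have [i0 ai0] : exists i, a i != 0.
  apply: contrapT => /forallNP a00; move/eqP: a1.
  by rewrite big1 ?[0 == _]eq_sym ?oner_eq0 // => i _; apply/eqP/negPn/negP.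
(* Points with coefficient 0 are replaced by one that is tight. *)
exists k, (fun i => if a i == 0 then v i0 else v i), a; split=> // [i|].
  by case: ifPn => ai; split=> //=; apply: tight.
rewrite xE; apply: eq_bigr => i _; case: ifPn => // /eqP ->; by rewrite !scale0r.
Qed.

Lemma polytope_vertices P : is_polytope P ->
  exists (s : nat) (v : 'I_s -> 'rV[R]_m), P = convex_hull (range v).
Proof.
case=> V [/finite_seqP[s ->] ->]; exists (size s), (tnth (in_tuple s)).
congr convex_hull; apply/seteqP; split=> [x /= xs|_ [i _ <-]] /=.
  by have /tnthP[i ->] : x \in in_tuple s by []; exists i.
exact: mem_tnth.
Qed.

Lemma is_faceI P c b : (forall x, P x -> dot x c <= b) ->
  is_face P (P `&` [set x | dot x c = b]).
Proof. by exists c, b. Qed.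

Variables (s : nat) (v : 'I_s -> 'rV[R]_m).
Let P := convex_hull (range v).

Lemma range_sub i : P (v i).
Proof. by apply: sub_convex_hull; exists i. Qed.

Lemma hull_le c b : (forall i, dot (v i) c <= b) -> forall x, P x -> dot x c <= b.
Proof. by move=> vc x; apply: convex_hull_le => _ [i _ <-]. Qed.

Lemma hull_face c b x : (forall i, dot (v i) c <= b) ->
  P x -> dot x c = b -> convex_hull (v @` [set i | dot (v i) c = b]) x.
Proof.
move=> vc Px xb; have /convex_hull_face : forall y, range v y -> dot y c <= b.
  by move=> _ [i _ <-].
move=> /(_ _ Px xb); congr (convex_hull _ x); apply/seteqP.
by split=> [_ [[i _ <-] /= vi]|_ [i /= vi <-]]; [exists i|split=> //; exists i].
Qed.

(** A face is the hull of the generators that it contains. *)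
Lemma finite_faces : finite_set (faces P).
Proof.
apply: (@sub_finite_set _ _ (range (fun X : {set 'I_s} => convex_hull (v @` [set` X])))).
  move=> F [c [b [Pc ->]]]; exists [set i | dot (v i) c == b]%SET => //.
  apply/seteqP; split=> [x|x [Px xb]].
    case=> k [w [a [wV a0 a1 ->]]]; split.
      exists k, w, a; split=> // i; have [j _ <-] := wV i; by exists j.
    rewrite /= -[LHS]/(dot _ c) dot_suml -[b]mul1r -a1 mulr_suml.
    apply: eq_bigr => i _; rewrite dotZl; congr (_ * _).
    by have [j /=] := wV i; rewrite inE => /eqP vj <-.
  have := hull_face (fun i => Pc _ (range_sub i)) Px xb.
  congr (convex_hull _ x); congr (v @` _); apply/seteqP.
  by split=> i /=; rewrite inE => /eqP.
by apply: finite_image; exact: finite_finset.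
Qed.

(** Perturb the functional that exposes F by a small multiple of u. On F the
    perturbation decides; off F the gap of the original functional is bounded below
    on the finitely many generators. *)
Lemma subface F u : is_face P F -> F !=set0 ->
  exists2 F', is_face P F' & F' !=set0 /\
    F' = F `&` [set x | forall y, F y -> dot y u <= dot x u].
Proof.
move=> [c [b [Pc FE]]] [x0 Fx0].
have vc i : dot (v i) c <= b := Pc _ (range_sub i).
have Fhull x : F x -> convex_hull (v @` [set i | dot (v i) c = b]) x.
  by rewrite FE => -[Px xb]; apply: hull_face.
have [i0 i0P] : exists i, dot (v i) c == b.
  case: (Fhull _ Fx0) => -[|k] [w [a [wV _ a1 _]]].
    by move: a1; rewrite big_ord0 => /eqP; rewrite eq_sym oner_eq0.
  by have [i /= /eqP ib _] := wV ord0; exists i.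
have [i /eqP ib imax] := @arg_maxP _ _ _ i0 (fun i => dot (v i) c == b) (fun i => dot (v i) u) i0P.
pose M := dot (v i) u.
have FM y : F y -> dot y u <= M.
  by move=> /Fhull; apply: convex_hull_le => _ [j /= /eqP jb <-]; exact: imax.
have Fi : F (v i) by rewrite FE; split => //; exact: range_sub.
have [e e0 eP] : exists2 e, 0 < e & forall j, dot (v j) c < b ->
    0 < (b - dot (v j) c) + e * (M - dot (v j) u).
  have [[j yj]|/forallNP ny] := pselect (exists j, M - dot (v j) u < 0).
    have [|||t [t0 tP _]] := @ratio_test _ _ (fun j => b - dot (v j) c)
      (fun j => M - dot (v j) u).
    - by move=> k; rewrite subr_ge0.
    - by move=> k /eqP; rewrite subr_eq0 eq_sym subr_ge0; exact: imax.
    - by exists j.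
    (* At time t some gap may be closed; at half the time all are still open. *)
    exists (t / 2) => [|k ck]; first by rewrite divr_gt0.
    have := tP k; move: ck; rewrite -subr_gt0; set X := b - _; set Y := M - _.
    by move=> X0 XY; rewrite mulrAC; nra.
  exists 1 => // j jb; rewrite mul1r ltr_wpDr ?subr_gt0 // leNgt.
  by apply/negP/ny.
have le j : dot (v j) (c + e *: u) <= b + e * M.
  rewrite dotDr dotZr -subr_ge0; have [ltb|] := ltP (dot (v j) c) b.
    by have := eP j ltb; lra.
  move=> geb; have jb : dot (v j) c == b by rewrite eq_le vc.
  rewrite (eqP jb) opprD addrACA subrr add0r -mulrBr mulr_ge0 ?(ltW e0) // subr_ge0; exact: imax.
exists (P `&` [set x | dot x (c + e *: u) = b + e * M]); first exact/is_faceI/hull_le.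
have E x : (P `&` [set x | dot x (c + e *: u) = b + e * M]) x <-> F x /\ dot x u = M.
  split=> [[Px xb]|[]].
    have := hull_face le Px xb; set V := v @` _ => Vx.
    have tight w : V w -> dot w c = b /\ dot w u = M.
      case=> j /=; rewrite dotDr dotZr => jb <-; have [ltb|] := ltP (dot (v j) c) b.
        by have := eP j ltb; rewrite mulrBr; move: jb; lra.
      move=> geb; have jcb : dot (v j) c = b by apply/eqP; rewrite eq_le vc.
      by split=> //; move: jb; rewrite jcb => /addrI /(mulfI (lt0r_neq0 e0)).
    have cx : dot x c <= b by exact: Pc.
    have ux : dot x u <= M by apply: convex_hull_le Vx => w /tight[_ ->].
    have xeM : dot x c + e * dot x u = b + e * M by rewrite -dotZr -dotDr.
    have eux : e * dot x u <= e * M by rewrite ler_pM2l.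
    have xcb : dot x c = b by lra.
    split; first by rewrite FE.
    by move: xeM; rewrite xcb => /addrI /(mulfI (lt0r_neq0 e0)).
  by rewrite FE => -[Px xb] xM; split=> //=; rewrite dotDr dotZr xM [dot x c]xb.
split; first by exists (v i); apply/E.
apply/seteqP; split=> x; first by move=> /E[Fx xM]; split=> //= y Fy; rewrite xM FM.
by move=> [Fx xmax]; apply/E; split=> //; apply/eqP; rewrite eq_le FM //= xmax.
Qed.

End VRepresentation.

(** Maximize u on F, and then each coordinate in turn: a single point remains. *)
Lemma face_has_vertex (R : realType) m (P F : set 'rV[R]_m) (u : 'cV[R]_m) :
  is_polytope P -> is_face P F -> F !=set0 ->
  exists2 x, F x & is_face P [set x] /\ forall y, F y -> dot y u <= dot x u.
Proof.
move=> /polytope_vertices[s [v PE]] faceF F0.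
have [G [faceG [x Gx] GF const]] : exists G, [/\ is_face P G, G !=set0,
    G `<=` [set x | F x /\ forall y, F y -> dot y u <= dot x u]
    & forall i x y, G x -> G y -> x 0 i = y 0 i].
  have [G0 faceG0 [G00 G0E]] : exists2 F', is_face P F' & F' !=set0 /\
      F' = F `&` [set x | forall y, F y -> dot y u <= dot x u].
    by rewrite PE in faceF *; exact: subface.
  suff [G [faceG GG0 GF const]] : exists G, [/\ is_face P G, G !=set0, G `<=` G0
      & forall i, i \in enum 'I_m -> forall x y, G x -> G y -> x 0 i = y 0 i].
    exists G; split=> // [x /GF|i x y]; first by rewrite G0E => -[].
    by apply: const; rewrite mem_enum.
  elim: (enum 'I_m) => [|i l [G [faceG GG0 GF const]]]; first by exists G0; split.
  have [G1 faceG1 [G10 G1E]] : exists2 F', is_face P F' & F' !=set0 /\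
      F' = G `&` [set x | forall y, G y -> dot y (delta_mx i 0) <= dot x (delta_mx i 0)].
    by rewrite PE in faceG *; exact: subface.
  have dotd x : dot x (delta_mx i 0) = x 0 i by rewrite /dot -colE mxE.
  exists G1; split=> // [x|j]; first by rewrite G1E => -[/GF].
  rewrite in_cons G1E => /predU1P[->|jl] x y [Gx xmax] [Gy ymax].
    by apply/eqP; rewrite -!dotd eq_le xmax ?ymax.
  exact: const.
have [Fx xmax] := GF x Gx; exists x => //; split=> //.
rewrite (_ : [set x] = G) //; apply/seteqP; split=> [_ ->//|y Gy /=].
by apply/matrixP => i j; rewrite ord1; apply: const.
Qed.

(** * Vertices and edges of a polygon *)

Lemma dot_trmx (F : fieldType) m (x : 'rV[F]_m) c : dot c^T x^T = dot x c.
Proof. by rewrite /dot -trmx_mul mxE. Qed.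

Lemma collinear2 (F : fieldType) (c : 'cV[F]_2) (w z : 'rV[F]_2) :
  c != 0 -> dot w c = 0 -> dot z c = 0 -> w != 0 -> exists t, z = t *: w.
Proof.
move=> c0 wc zc w0; have inK x : dot x c = 0 -> (x <= kermx c)%MS.
  move=> xc; apply/sub_kermxP/matrixP => i j; rewrite !ord1 [RHS]mxE; exact: xc.
have rc : \rank c = 1%N.
  apply/eqP; rewrite eqn_leq rank_leq_col lt0n mxrank_eq0 c0 //.
have := mxrank_leqif_eq (inK w wc); rewrite mxrank_ker rc rank_rV w0 => -[_ /esym].
by rewrite eqxx => /eqmxP wK; apply/sub_rVP; rewrite wK inK.
Qed.

Lemma collinear2_dual (F : fieldType) (q : 'rV[F]_2) (u w : 'cV[F]_2) :
  q != 0 -> dot q u = 0 -> dot q w = 0 -> u != 0 -> exists t, w = t *: u.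
Proof.
rewrite -(trmx_eq0 q) -(trmx_eq0 u) -(dot_trmx q u) -(dot_trmx q w) => q0 qu qw u0.
have [t wt] := collinear2 q0 qu qw u0; exists t; apply: trmx_inj.
by rewrite linearZ.
Qed.

Section Polygon.
Variables (R : realType) (P : set 'rV[R]_2).
Hypothesis dimP : is_dpolytope 2 P.
Implicit Types (F E : set 'rV[R]_2) (c u : 'cV[R]_2) (x y z : 'rV[R]_2).

(** In a polygon, the nonempty faces other than the vertices and the polygon
    itself are the edges; in this form no dimension has to be computed for them. *)
Definition proper_edge F : Prop :=
  [/\ is_face P F, F !=set0, ~ has_dim F 0 & F <> P].

(** The affine hull of P is the whole plane. *)
Lemma polygon_const c b : (forall x, P x -> dot x c = b) -> c = 0.
Proof.
move=> Pc; case: dimP => _ [x0 [D [rD hD]]].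
have allb y : dot y c = b.
  have : affine_hull P y.
    rewrite hD /=; apply: submx_full; rewrite /row_full; exact/eqP.
  case=> k [w [a [wP a1 ->]]]; rewrite dot_suml -[b]mul1r -a1 mulr_suml.
  by apply: eq_bigr => i _; rewrite dotZl Pc.
have b0 : b = 0 by rewrite -(allb 0) dot0l.
by apply: dot_inj => x; rewrite allb.
Qed.

Lemma polygon_nonempty : P !=set0.
Proof.
apply: contrapT => P0; have /matrixP/(_ 0 0) : const_mx 1 = 0 :> 'cV[R]_2.
  by apply: (polygon_const (b := 0)) => x Px; case: P0; exists x.
by rewrite !mxE => /eqP; rewrite oner_eq0.
Qed.

Lemma polygon_not_vertex : ~ has_dim P 0.
Proof. by move=> /has_dim_uniq /(_ dimP.2). Qed.

Lemma edge_exposed F : proper_edge F -> exists c b,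
  [/\ c != 0, forall x, P x -> dot x c <= b & F = P `&` [set x | dot x c = b]].
Proof.
case=> [[c [b [Pc FE]]] [x Fx] _ FP]; exists c, b; split=> //.
apply: contra_not_neq FP => c0; rewrite FE; apply/seteqP; split=> [y []//|y Py].
split=> //=; move: Fx; rewrite FE c0 => -[_ /=].
by rewrite !mulmx0 !mxE.
Qed.

Lemma edge_points F : F !=set0 -> ~ has_dim F 0 -> forall x, F x ->
  exists2 y, F y & y != x.
Proof.
move=> F0 Fdim x Fx; apply: contrapT => nx; apply: Fdim.
have -> : F = [set x]; last exact: has_dim_set1.
apply/seteqP; split=> [y Fy /=|y ->//].
by apply/eqP/negPn/negP => yx; apply: nx; exists y.
Qed.

(** The functional that exposes F takes the same value at two points of F, so it
    is constant on the line through E. *)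
Lemma edge_incl F E : proper_edge F -> proper_edge E -> F `<=` E -> F = E.
Proof.
move=> eF eE FE; apply/seteqP; split=> // z Ez.
have [_ [x Fx] dF _] := eF; have [y Fy yx] := edge_points (ex_intro _ x Fx) dF Fx.
have [c [b [c0 Pc EE]]] := edge_exposed eE.
have [c' [b' [_ _ FE']]] := edge_exposed eF.
have Ec w : E w -> dot w c = b by rewrite EE => -[].
have [||//|t zE] := @collinear2 _ c (y - x) (z - x) c0.
- by rewrite dotBl !Ec ?subrr; auto.
- by rewrite dotBl !Ec ?subrr; auto.
- by rewrite subr_eq0.
have zx : z = x + t *: (y - x) by rewrite -zE addrC subrK.
rewrite FE'; split; first by move: Ez; rewrite EE => -[].
have Fc w : F w -> dot w c' = b' by rewrite FE' => -[].
by rewrite /= -[LHS]/(dot z c') zx dotDl dotZl dotBl !Fc // subrr mulr0 addr0.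
Qed.

(** The two ends maximize and minimize the direction of the edge. A vertex
    strictly between them could not be exposed. *)
Lemma edge_vertices F : proper_edge F -> exists x y, [/\ x != y,
  is_face P [set x], is_face P [set y] & F x /\ F y] /\
  forall z, is_face P [set z] -> F z -> z = x \/ z = y.
Proof.
move=> eF; have [faceF F0 dF _] := eF; have [polyP _] := dimP.
have [a Fa] := F0; have [b Fb ba] := edge_points F0 dF Fa.
pose u := (b - a)^T; have u0 : dot (b - a) u != 0.
  apply: contra_neq ba => /eqP; rewrite dotE.
  under eq_bigr do rewrite [u _ _]mxE -expr2.
  rewrite psumr_eq0 => [/allP ab|i _]; last exact: sqr_ge0.
  apply/eqP; rewrite -subr_eq0; apply/eqP/matrixP => i j; rewrite ord1 [RHS]mxE.
  by have := ab j (mem_index_enum _); rewrite sqrf_eq0 => /eqP.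
have [x Fx [fx xmax]] := face_has_vertex u polyP faceF F0.
have [y Fy [fy ymin]] := face_has_vertex (- u) polyP faceF F0.
have {}ymin z : F z -> dot y u <= dot z u.
  by move=> /ymin; rewrite !dotNr lerN2.
have ltyx : dot y u < dot x u.
  rewrite ltNge; apply/negP => lexy; move/eqP: u0; apply.
  have cst z : F z -> dot z u = dot x u.
    move=> Fz; apply/eqP; rewrite eq_le xmax //=; exact: le_trans lexy (ymin z Fz).
  by rewrite dotBl !cst // subrr.
have xy : x != y by apply: contraTneq ltyx => ->; rewrite ltxx.
exists x, y; split=> // z [c [d [Pc zE]]] Fz.
have [e [f [e0 Pe FE]]] := edge_exposed eF.
have Fe w : F w -> dot w e = f by rewrite FE => -[].
have PF w : F w -> P w by rewrite FE => -[].
have [|||t ztE] := @collinear2 _ e (y - x) (z - x) e0.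
- by rewrite dotBl !Fe // subrr.
- by rewrite dotBl !Fe // subrr.
- by rewrite subr_eq0 eq_sym.
have zx : z = x + t *: (y - x) by rewrite -ztE addrC subrK.
have tight w : P w -> dot w c = d -> w = z.
  move=> Pw wc; suff: [set z] w by []. by rewrite zE.
have zc : dot z c = d by have : [set z] z by []; rewrite {1}zE => -[].
have [xc yc] : dot x c <= d /\ dot y c <= d by split; apply: Pc; apply: PF.
have [zu1 zu2] := (xmax z Fz, ymin z Fz).
rewrite zx dotDl dotZl dotBl in zu1 zu2; rewrite zx dotDl dotZl dotBl in zc.
have [xd|xd] := eqVneq (dot x c) d; first by left; apply/esym/tight; auto.
have [yd|yd] := eqVneq (dot y c) d; first by right; apply/esym/tight; auto.
have {xc xd}xd : dot x c < d by rewrite lt_neqAle xd.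
have {yc yd}yd : dot y c < d by rewrite lt_neqAle yd.
have t0 : 0 <= t.
  by move: zu1; rewrite gerDl nmulr_lle0 // subr_lt0.
have t1 : t <= 1.
  by rewrite -subr_ge0 -(nmulr_lle0 _ (_ : dot y u - dot x u < 0)) ?subr_lt0 //; lra.
exfalso; move: zc => /eqP; apply/negP; rewrite lt_eqF //.
have [leyx|/ltW lexy] := leP (dot y c) (dot x c).
  by apply: le_lt_trans xd; rewrite gerDl mulr_ge0_le0 // subr_le0.
apply: le_lt_trans yd; rewrite -lerBrDl -[leRHS]mul1r ler_wpM2r // subr_ge0 //.
Qed.

(** Let q be the sum of the vectors from the generators of P to x, and let u be a
    functional that vanishes at q. Up to scaling, the nonzero functionals that
    are maximal at x are of the form c + t u, and the ratio test finds exactly one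
    positive and one negative t for which more than x is exposed. *)
Lemma vertex_edges x : is_face P [set x] -> exists E1 E2,
  [/\ E1 <> E2, proper_edge E1, proper_edge E2 & E1 x /\ E2 x] /\
  forall E, proper_edge E -> E x -> E = E1 \/ E = E2.
Proof.
move=> [c [b [Pc xE]]]; have [Px xcb'] : (P `&` [set y | dot y c = b]) x by rewrite -xE.
have {xcb'} xcb : dot x c = b := xcb'.
have [/polytope_vertices[s [v PE]] _] := dimP.
have Pv i : P (v i) by rewrite PE; exact: range_sub.
pose p i := x - v i; pose q := \sum_i p i.
have dotq w : dot q w = \sum_i dot (p i) w by exact: dot_suml.
have p_const w : (forall i, dot (p i) w = 0) -> w = 0.
  move=> pw; apply: (polygon_const (b := dot x w)) => y; rewrite PE => Py.
  have vw i : dot (v i) w = dot x w.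
    by apply/esym/eqP; rewrite -subr_eq0 -dotBl pw.
  apply/eqP; rewrite eq_le (hull_le _ Py) /= => [|i]; last by rewrite vw.
  by rewrite -lerN2 -!dotNr (hull_le _ Py) // => i; rewrite !dotNr vw.
have p_ge0 w i : (forall y, P y -> dot y w <= dot x w) -> 0 <= dot (p i) w.
  by move=> xw; rewrite dotBl subr_ge0 xw.
have q_gt0 w : (forall y, P y -> dot y w <= dot x w) -> w != 0 -> 0 < dot q w.
  move=> xw w0; rewrite lt_neqAle dotq sumr_ge0 ?andbT => [|i _]; last exact: p_ge0.
  rewrite eq_sym; apply: contra w0 => /eqP/psumr_eq0P pw; apply/eqP/p_const => i.
  by apply: pw => // j _; exact: p_ge0.
have xc y : P y -> dot y c <= dot x c by move=> /Pc; rewrite xcb.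
have c0 : c != 0.
  apply/eqP => c0; apply: polygon_not_vertex; rewrite (_ : P = [set x]).
    exact: has_dim_set1.
  rewrite xE; apply/seteqP; split=> [y Py|y []//]; split=> //.
  by rewrite /= -xcb c0 /dot !mulmx0.
have pc0 i : dot (p i) c = 0 -> p i = 0.
  move/eqP; rewrite dotBl subr_eq0 xcb eq_sym => /eqP vb.
  suff: [set x] (v i) by rewrite /p => /= ->; rewrite subrr.
  by rewrite xE.
have [|u u0 qu'] := @exists_annihilator _ _ unit (fun=> q); first by rewrite card_unit.
have {qu'}qu : dot q u = 0 := qu' tt.
pose Et t := P `&` [set y | dot y (c + t *: u) = dot x (c + t *: u)].
have pivot w : w != 0 -> dot q w = 0 -> exists t, [/\ 0 < t,
    forall i, 0 <= dot (p i) c + t * dot (p i) w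
    & exists2 i, dot (p i) w < 0 & dot (p i) c + t * dot (p i) w = 0].
  move=> w0 qw; apply: ratio_test => [i|i /pc0 ->|].
  - exact: p_ge0.
  - by rewrite dot0l.
  - apply: contrapT => /forallNP nw; case/eqP: w0; apply: p_const => i.
    have wge j : true -> 0 <= dot (p j) w by move=> _; rewrite leNgt; apply/negP/nw.
    by move: qw; rewrite dotq => /(psumr_eq0P wge) ->.
have Et_edge t : (forall i, 0 <= dot (p i) c + t * dot (p i) u) ->
    (exists2 i, p i != 0 & dot (p i) c + t * dot (p i) u = 0) -> proper_edge (Et t).
  move=> ge0 [j pj0 pj].
  have xEt : Et t x by [].
  have vEt : Et t (v j).
    split=> //=; apply/esym/eqP; rewrite -subr_eq0 -/(dot x _) -/(dot (v j) _).
    by rewrite -dotBl dotDr dotZr; exact/eqP.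
  split.
  - apply: is_faceI => y; rewrite PE => /hull_le; apply => i.
    by rewrite -subr_ge0 -dotBl dotDr dotZr; exact: ge0.
  - by exists x.
  - move=> /has_dim0P[z zE]; move: xEt vEt; rewrite zE /= => xz vz.
    by case/eqP: pj0; rewrite /p xz vz subrr.
  - move=> EP; have ct0 : c + t *: u = 0.
      by apply: (@polygon_const _ (dot x (c + t *: u))) => y; rewrite -EP => -[].
    have := q_gt0 c xc c0; rewrite -[c](addrK (t *: u)) ct0 sub0r dotNr dotZr qu.
    by rewrite mulr0 oppr0 ltxx.
have [t [t0 tge [i ui ti]]] := pivot u u0 qu.
have [||t' [t'0 t'ge [j uj t'j]]] := pivot (- u).
- by rewrite oppr_eq0.
- by rewrite dotNr qu oppr0.
have p0 k w : dot (p k) w < 0 -> p k != 0.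
  by apply: contraTneq => ->; rewrite dot0l ltxx.
have sgn k : dot (p k) c + t' * dot (p k) (- u) = dot (p k) c + - t' * dot (p k) u.
  by rewrite dotNr mulrN mulNr.
exists (Et t), (Et (- t')); split; first split.
- move=> EE; have vi : Et t (v i).
    split=> //=; apply/esym/eqP; rewrite -subr_eq0 -/(dot x _) -/(dot (v i) _).
    by rewrite -dotBl dotDr dotZr; exact/eqP.
  have := vi; rewrite EE => -[_ /= /esym/eqP]; rewrite -subr_eq0 -/(dot x _) -/(dot (v i) _).
  rewrite -dotBl dotDr dotZr => /eqP t'i.
  have : (t + t') * dot (p i) u = 0 by move: ti t'i; rewrite -/(p i); lra.
  by move/eqP; rewrite mulf_eq0 (lt_eqF ui) orbF gt_eqF // addr_gt0.
- by apply: Et_edge => //; exists i => //; apply: p0 ui.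
- apply: Et_edge => [k|]; first by rewrite -sgn.
  by exists j; [apply: p0 uj|rewrite -sgn].
- by split.
move=> E eE Ex; have [w [d [w0 Pw EE]]] := edge_exposed eE.
have xw : dot x w = d by move: Ex; rewrite EE => -[].
have {}Pw y : P y -> dot y w <= dot x w by rewrite xw; exact: Pw.
have qc : 0 < dot q c := q_gt0 c xc c0.
have qw : 0 < dot q w := q_gt0 w Pw w0.
(* The functional w of E is positive at q, hence is a positive multiple of
   some c + tau u. *)
pose a := dot q w / dot q c; have a0 : 0 < a by rewrite divr_gt0.
have q0 : q != 0 by apply: contraTneq qc => ->; rewrite dot0l ltxx.
have [|tau] := @collinear2_dual _ q u (a^-1 *: w - c) q0 qu _ u0.
  rewrite dotBr dotZr invf_div mulfVK ?subrr // gt_eqF //.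
move=> wE; have {}wE : w = a *: (c + tau *: u).
  by rewrite -wE addrC subrK scalerA divff ?scale1r // gt_eqF.
have EEt : E = Et tau.
  rewrite EE -xw; apply/seteqP; split=> y [Py /= yw]; split=> //=; move: yw;
    rewrite -/(dot _ w) -/(dot _ (c + _)) ?wE ?dotZr.
    by move/(mulfI (lt0r_neq0 a0)).
  by move=> ->.
have tauge k : 0 <= dot (p k) c + tau * dot (p k) u.
  have := p_ge0 w k Pw; rewrite wE dotZr dotDr dotZr pmulr_rge0 //.
have [k pk0 pk] : exists2 k, p k != 0 & dot (p k) c + tau * dot (p k) u = 0.
  apply: contrapT => /forall2NP nk; have [_ _ dE _] := eE.
  have [y] := edge_points (ex_intro _ x Ex) dE Ex; rewrite EE PE => -[Py yd] /eqP; apply.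
  have vw o : dot (v o) w <= d by rewrite -xw Pw.
  have := hull_face vw Py yd; case=> m [z [e [zV _ e1 ->]]].
  have zx l : z l = x.
    have [o /= ow <-] := zV l; have [/negP|] := nk o; last first.
      case; have : dot (p o) w = 0 by rewrite dotBl xw [dot (v o) w]ow subrr.
      by rewrite wE dotZr dotDr dotZr => /eqP; rewrite mulf_eq0 gt_eqF // => /eqP.
    by rewrite negbK subr_eq0 => /eqP.
  by under eq_bigr do rewrite zx; rewrite -scaler_suml e1 scale1r.
have [tau0|tau0|tau0] := ltgtP tau 0.
- right; rewrite EEt; congr Et; apply: oppr_inj; rewrite opprK.
  apply: (@ratio_test_uniq _ _ (fun k => dot (p k) c) (fun k => dot (p k) (- u))) => //.
  + by move=> l; rewrite dotNr mulrNN.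
  + exists k; last by rewrite dotNr mulrNN.
    rewrite dotNr oppr_lt0; have : 0 < dot (p k) c.
      by rewrite lt_neqAle p_ge0 // andbT; apply: contraNneq pk0 => /esym/pc0 ->.
    by move: pk tau0; nra.
  + by exists j.
- left; rewrite EEt; congr Et.
  apply: (@ratio_test_uniq _ _ (fun k => dot (p k) c) (fun k => dot (p k) u)) => //.
  + exists k => //; have : 0 < dot (p k) c.
      by rewrite lt_neqAle p_ge0 // andbT; apply: contraNneq pk0 => /esym/pc0 ->.
    by move: pk tau0; nra.
  + by exists i.
- case/eqP: pk0; apply: pc0; by move: pk; rewrite tau0 mul0r addr0.
Qed.

End Polygon.

(** * Faces of a product, and simple vertices *)

Section ProductFaces.
Variables (R : realType) (r : nat).
Implicit Types (x : 'rV[R]_(r * 2)) (c : 'cV[R]_(r * 2)) (G : 'I_r -> set 'rV[R]_2).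

Definition component i x : 'rV[R]_2 := row i (vec_mx x).
Definition assemble (y : 'I_r -> 'rV[R]_2) : 'rV[R]_(r * 2) := mxvec (\matrix_i y i).

Lemma component_assemble y i : component i (assemble y) = y i.
Proof. by rewrite /component /assemble mxvecK rowK. Qed.

Lemma dot_components x c : dot x c = \sum_i dot (component i x) (component i c^T)^T.
Proof.
rewrite dotE (reindex (uncurry (@mxvec_index r 2))) /=; last exact: curry_mxvec_bij.
rewrite (eq_bigr (fun ij => x 0 (mxvec_index ij.1 ij.2) * c (mxvec_index ij.1 ij.2) 0)) => [|[] //].
rewrite -(pair_bigA _ (fun i j => x 0 (mxvec_index i j) * c (mxvec_index i j) 0)) /=.
by apply: eq_bigr => i _; rewrite dotE; apply: eq_bigr => j _; rewrite !mxE.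
Qed.

Lemma dot_assemble x (C : 'I_r -> 'cV[R]_2) :
  dot x (assemble (fun i => (C i)^T))^T = \sum_i dot (component i x) (C i).
Proof.
rewrite dot_components; apply: eq_bigr => i _.
by rewrite trmxK component_assemble trmxK.
Qed.

Lemma sum_tight (a b : 'I_r -> R) : (forall i, a i <= b i) ->
  \sum_i a i = \sum_i b i -> forall i, a i = b i.
Proof.
move=> ab s i; have ba0 j : true -> 0 <= b j - a j by rewrite subr_ge0.
have s0 : \sum_i (b i - a i) = 0 by rewrite sumrB s subrr.
by apply/esym/eqP; rewrite -subr_eq0; apply/eqP/(psumr_eq0P ba0 s0).
Qed.

Variable Pn : set 'rV[R]_2.
Let Pr := prod_set (fun _ : 'I_r => Pn).

Lemma prod_set_face G : (forall i, is_face Pn (G i)) -> is_face Pr (prod_set G).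
Proof.
move=> /choice[C] /choice[b Cb].
have le x : Pr x -> forall i, dot (component i x) (C i) <= b i.
  by move=> Px i; apply: (Cb i).1; exact: Px.
exists (assemble (fun i => (C i)^T))^T, (\sum_i b i); split=> [x Px|].
  by rewrite -/(dot x _) dot_assemble; apply: ler_sum => i _; exact: le.
apply/seteqP; split=> x.
  move=> Gx; have GC i : Pn (component i x) /\ dot (component i x) (C i) = b i.
    by have := Gx i; rewrite (Cb i).2.
  split=> [i|]; first exact: (GC i).1.
  by rewrite /= -/(dot x _) dot_assemble; apply: eq_bigr => i _; exact: (GC i).2.
move=> [Px]; rewrite /= -/(dot x _) dot_assemble => /(sum_tight (le x Px)) xb i.
by rewrite (Cb i).2; split; [exact: Px|exact: xb].
Qed.

(** Replacing a single component of a point of F shows that the functional is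
    maximal in each component separately. *)
Lemma prod_set_face_inv F : is_face Pr F -> F !=set0 ->
  exists G, (forall i, is_face Pn (G i) /\ G i !=set0) /\ F = prod_set G.
Proof.
move=> [c [b [Pc FE]]] [x Fx]; have [Px xb] : Pr x /\ dot x c = b by move: Fx; rewrite FE.
pose C i := (component i c^T)^T; pose B i := dot (component i x) (C i).
have le i y : Pn y -> dot y (C i) <= B i.
  move=> Py; pose z := assemble (fun j => if j == i then y else component j x).
  have /Pc : Pr z.
    by move=> j; rewrite -/(component j z) component_assemble; case: ifP => // _; exact: Px.
  rewrite -/(dot z c) -xb !dot_components (bigD1 i) //= [leRHS](bigD1 i) //=.
  rewrite component_assemble eqxx (eq_bigr (fun j => dot (component j x) (C j))) ?lerD2r //.
  by move=> j /negPf ji; rewrite component_assemble ji.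
have bE : b = \sum_i B i by rewrite -xb dot_components.
exists (fun i => Pn `&` [set y | dot y (C i) = B i]); split=> [i|].
  by split; [exact/is_faceI/le|exists (component i x); split=> //; exact: Px].
rewrite FE; apply/seteqP; split=> y.
  move=> [Py yb] i; split; first exact: Py.
  apply: (@sum_tight (fun i => dot (component i y) (C i))) => [j|]; first exact/le/Py.
  by rewrite -bE -dot_components.
move=> yG; split=> [i|]; first by case: (yG i).
rewrite /= -/(dot y c) dot_components bE; apply: eq_bigr => i _.
by case: (yG i).
Qed.

Lemma prod_set_sub G G' : (forall i, G i !=set0) ->
  prod_set G `<=` prod_set G' <-> forall i, G i `<=` G' i.
Proof.
move=> /choice[y Gy]; split=> [sub i z Giz|sub x Gx i]; last exact/sub/Gx.
pose w := assemble (fun j => if j == i then z else y j).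
have /sub/(_ i) : prod_set G w.
  by move=> j; rewrite -/(component j w) component_assemble; case: eqP => [->|].
by rewrite -/(component i w) component_assemble eqxx.
Qed.

End ProductFaces.

(** A square matrix with a right inverse is invertible. *)
Lemma biorthogonal_total (F : fieldType) m (J : finType) (d : J -> 'rV[F]_m)
    (c : J -> 'cV[F]_m) : #|J| = m ->
  (forall i j, dot (d i) (c j) = (i == j)%:R) ->
  forall w, (forall j, dot (d j) w = 0) -> w = 0.
Proof.
move=> Jm; case: _ / Jm d c => d c dc w dw.
pose D := \matrix_(k < #|J|) d (enum_val k).
pose C : 'M_#|J| := \matrix_(i, k) c (enum_val k) i 0.
have DC : D *m C = 1%:M.
  apply/matrixP => i k; rewrite [RHS]mxE -(inj_eq enum_val_inj) -dc dotE mxE.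
  by apply: eq_bigr => l _; rewrite !mxE.
have Dw : D *m w = 0.
  apply/matrixP => i k; rewrite ord1 [RHS]mxE -[RHS](dw (enum_val i)) dotE mxE.
  by apply: eq_bigr => l _; rewrite mxE.
by rewrite -[w]mul1mx -(mulmx1C DC) -mulmxA Dw mulmx0.
Qed.

Section Corner.
Variables (R : realType) (m : nat) (J : finType) (P : set 'rV[R]_m).
Variable F : {set J} -> set 'rV[R]_m.
Implicit Types (S : {set J}) (x : 'rV[R]_m) (delta : J -> 'rV[R]_m) (u : J -> 'cV[R]_m).

(** A simple vertex x of P with its edge directions delta; F maps a set of edges at
    x to the face that they span. *)
Record corner x delta u : Prop := Corner {
  corner_apex : F finset.set0 x;
  corner_edge : forall j, F [set j]%SET (x + delta j);
  corner_dual : forall i j, dot (delta i) (u j) = (i == j)%:R;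
  corner_span : forall y, y = \sum_j dot y (u j) *: delta j;
  corner_ge0 : forall y j, P y -> 0 <= dot (y - x) (u j);
  corner_face : forall S y, F S y <-> P y /\ forall j, j \notin S -> dot (y - x) (u j) = 0
}.

(** A functional that exposes the facet F (~: [set j]) vanishes on all edge
    directions but the one at j, where it is negative. There are as many such
    facets as dimensions, so up to scaling these functionals are the basis dual to
    the edge directions. *)
Lemma exists_corner : #|J| = m -> (forall S, is_face P (F S)) ->
  {homo F : S S' / S \subset S' >-> S `<=` S'} -> F finset.set0 !=set0 ->
  (forall j, ~ (F [set j]%SET `<=` F (~: [set j])%SET)) ->
  exists x delta u, corner x delta u.
Proof.
move=> cJ faceF monoF [x Fx] notF.
have FP S y : F S y -> P y by have [c [b [_ ->]]] := faceF S; case.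
have /choice[w wP] j : exists y, F [set j]%SET y /\ ~ F (~: [set j])%SET y.
  apply: contrapT => /forallNP H; apply: (notF j) => y Fy.
  by apply: contrapT => nF; apply: (H y).
have /choice[c] j := faceF (~: [set j])%SET.
move=> /choice[b cb].
have xb j : dot x (c j) = b j.
  have : F (~: [set j])%SET x by apply: monoF Fx; exact: finset.sub0set.
  by rewrite (cb j).2 => -[].
pose d j := w j - x.
have d_off i j : i != j -> dot (d i) (c j) = 0.
  move=> ij; have : F (~: [set j])%SET (w i).
    by apply: monoF (wP i).1; rewrite finset.sub1set !inE.
  by rewrite (cb j).2 dotBl xb => -[_ /= wb]; rewrite [dot (w i) _]wb subrr.
have d_on j : dot (d j) (c j) < 0.
  rewrite dotBl xb subr_lt0 lt_neqAle (cb j).1 ?andbT; last exact: FP (wP j).1.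
  apply/eqP => wb; apply: (wP j).2; rewrite (cb j).2; split=> //; exact: FP (wP j).1.
pose u j := (dot (d j) (c j))^-1 *: c j.
have du i j : dot (d i) (u j) = (i == j)%:R.
  rewrite dotZr; case: eqVneq => [->|/d_off ->]; last by rewrite mulr0.
  by rewrite mulVf // lt_eqF.
have [u' du' span] := dual_basis cJ (biorthogonal_total cJ du).
have u'E j : u' j = u j.
  apply: (subr0_eq); apply: (biorthogonal_total cJ du) => i.
  by rewrite dotBr du du' subrr.
have ge0 y j : P y -> 0 <= dot (y - x) (u j).
  by move=> Py; rewrite dotZr nmulr_rge0 ?invr_lt0 // dotBl xb subr_le0 (cb j).1.
exists x, d, u; split=> // [j|y|S y].
- by rewrite /d addrC subrK; exact: (wP j).1.
- by rewrite {1}[y]span; apply: eq_bigr => j _; rewrite u'E.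
split=> [FSy|[Py y0]].
  split=> [|j jS]; first exact: FP FSy.
  have : F (~: [set j])%SET y.
    by apply: monoF FSy; apply/fintype.subsetP => i iS; rewrite !inE; apply: contraNneq jS => <-.
  rewrite (cb j).2 => -[_ /= yb]; have yx : dot (y - x) (c j) = 0.
    by rewrite dotBl xb; apply/eqP; rewrite subr_eq0; exact/eqP.
  by rewrite dotZr yx mulr0.
have [e [f [Pe FE]]] := faceF S.
have FSx : F S x by apply: monoF Fx; exact: finset.sub0set.
rewrite FE; split=> //=; rewrite -/(dot y e).
have Fe z : F S z -> dot z e = f by rewrite FE => -[].
rewrite -(Fe _ FSx); apply/eqP; rewrite -subr_eq0 -dotBl [y - x]span dot_suml big1 //.
move=> j _; rewrite dotZl u'E; have [jS|/y0 ->] := boolP (j \in S); last by rewrite mul0r.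
have FSw : F S (w j) by apply: monoF (wP j).1; rewrite finset.sub1set.
by rewrite [dot (d j) e]dotBl (Fe _ FSw) (Fe _ FSx) subrr mulr0.
Qed.
End Corner.

(** * Projecting the faces at a simple vertex *)

Lemma rank_biorthogonal (F : fieldType) m (K : finType) (e : K -> 'rV[F]_m)
    (w : K -> 'cV[F]_m) : (forall k l, dot (e k) (w l) = (k == l)%:R) ->
  \rank (\matrix_(k < #|K|) e (enum_val k)) = #|K|.
Proof.
move=> ew; apply/eqP; rewrite eqn_leq rank_leq_row /=.
pose D := \matrix_(k < #|K|) e (enum_val k).
pose C : 'M_(m, #|K|) := \matrix_(i, k) w (enum_val k) i 0.
have DC : D *m C = 1%:M.
  apply/matrixP => i k; rewrite [RHS]mxE -(inj_eq enum_val_inj) -ew dotE mxE.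
  by apply: eq_bigr => l _; rewrite !mxE.
by rewrite -[X in (X <= _)%N](mxrank1 F) -DC mxrankM_maxl.
Qed.

Lemma has_dim_nonempty (R : realType) m (S : set 'rV[R]_m) d : has_dim S d -> S !=set0.
Proof.
move=> [x [D [_ hD]]]; have : affine_hull S x by rewrite hD /= subrr sub0mx.
case=> -[|k] [v [a [vS a1 _]]]; last by exists (v ord0).
by move: a1; rewrite big_ord0 => /eqP; rewrite eq_sym oner_eq0.
Qed.

Lemma polytope_proj (R : realType) m k (A : 'M[R]_(m, k)) (P : set 'rV[R]_m) :
  is_polytope P -> is_polytope (proj A @` P).
Proof.
case=> V [finV ->]; exists (proj A @` V); split; first exact: finite_image.
have projE l (v : 'I_l -> 'rV[R]_m) a :
    (\sum_i a i *: v i) *m A = \sum_i a i *: proj A (v i).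
  by rewrite mulmx_suml; apply: eq_bigr => i _; rewrite scalemxAl.
apply/seteqP; split=> [_ [_ [l [v [a [vV a0 a1 ->]]]] <-]|y].
  by exists l, (proj A \o v), a; split=> // [i|]; [exists (v i)|exact: projE].
case=> l [w [a [wV a0 a1 ->]]].
have /choice[v vP] i : exists v, V v /\ proj A v = w i by case: (wV i) => v; exists v.
exists (\sum_i a i *: v i); first by exists l, v, a; split=> // i; exact: (vP i).1.
by rewrite /proj projE; apply: eq_bigr => i _; rewrite (vP i).2.
Qed.

(** The part of P over a face of its projection. *)
Definition shadow_face (R : realType) m k (A : 'M[R]_(m, k)) (P X : set 'rV[R]_m) :=
  exists (c : 'cV[R]_k) (b : R), (forall y, P y -> dot (proj A y) c <= b) /\
    X = P `&` [set y | dot (proj A y) c = b].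

Section Shadow.
Variables (R : realType) (m k : nat) (A : 'M[R]_(m, k)) (P : set 'rV[R]_m).
Implicit Types X : set 'rV[R]_m.

Lemma shadow_face_sub X : shadow_face A P X -> X `<=` P.
Proof. by move=> [c [b [_ ->]]] x []. Qed.

Lemma shadow_face_is_face X : shadow_face A P X -> is_face P X.
Proof.
move=> [c [b [Pc ->]]]; exists (A *m c), b; split=> [x Px|].
  by rewrite mulmxA; exact: Pc.
by apply/seteqP; split=> x [Px /= xb]; split=> //=; move: xb; rewrite -?mulmxA // mulmxA.
Qed.

Lemma survives_shadow X : survives A P X -> shadow_face A P X.
Proof.
case=> [[c [b [Qc XE]]] <- _]; exists c, b; split=> [y Py|].
  by apply: Qc; exists y.
rewrite XE; apply/seteqP; split=> y [Py]; first by case.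
by move=> yb; split=> //; split=> //; exists y.
Qed.

Lemma shadow_face_proj X : shadow_face A P X -> is_face (proj A @` P) (proj A @` X).
Proof.
move=> [c [b [Pc ->]]]; exists c, b; split=> [_ [y Py <-]|]; first exact: Pc.
apply/seteqP; split=> [_ [y [Py yb] <-]|_ [[y Py <-] yb]].
  by split=> //; exists y.
by exists y.
Qed.

Lemma shadow_face_inj X X' : shadow_face A P X -> shadow_face A P X' ->
  proj A @` X = proj A @` X' -> X = X'.
Proof.
have sub Y Y' : shadow_face A P Y -> shadow_face A P Y' ->
    proj A @` Y = proj A @` Y' -> Y `<=` Y'.
  move=> sY [c [b [Pc YE']]] YY' y Yy.
  have : (proj A @` Y') (proj A y) by rewrite -YY'; exists y.
  rewrite YE' => -[z [Pz /= zb] yz].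
  by split; [exact: shadow_face_sub Yy|rewrite /= -yz].
by move=> sX sX' XX'; apply/seteqP; split; apply: sub.
Qed.

Lemma face_proj_shadow H : is_face (proj A @` P) H ->
  exists2 X, shadow_face A P X & H = proj A @` X.
Proof.
move=> [c [b [Qc HE]]]; exists (P `&` [set y | dot (proj A y) c = b]).
  by exists c, b; split=> // y Py; apply: Qc; exists y.
rewrite HE; apply/seteqP; split=> [_ [[y Py <-] yb]|_ [y [Py yb] <-]].
  by exists y.
by split=> //; exists y.
Qed.

End Shadow.

Section CornerShadow.
Variables (R : realType) (m : nat) (J : finType) (P : set 'rV[R]_m).
Variables (F : {set J} -> set 'rV[R]_m) (x : 'rV[R]_m).
Variables (delta : J -> 'rV[R]_m) (u : J -> 'cV[R]_m).
Hypothesis cornerF : corner P F x delta u.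
Implicit Types S : {set J}.

Lemma corner_sub S y : F S y -> P y.
Proof. by move=> /(corner_face cornerF)[]. Qed.

Lemma corner_apex_mem S : F S x.
Proof.
apply/(corner_face cornerF); split=> [|j _]; first exact: corner_sub (corner_apex cornerF).
by rewrite subrr dot0l.
Qed.

Lemma corner_edge_mem S j : F S (x + delta j) <-> j \in S.
Proof.
split=> [/(corner_face cornerF)[_ H]|jS].
  apply/negPn/negP => /H; rewrite addrC addKr (corner_dual cornerF) eqxx => /eqP.
  by rewrite oner_eq0.
apply/(corner_face cornerF); split=> [|i iS].
  exact: corner_sub (corner_edge cornerF j).
rewrite addrC addKr (corner_dual cornerF); case: eqP => // ji.
by rewrite -ji jS in iS.
Qed.

Lemma corner_inj : injective F.
Proof.
move=> S S' FSS'; apply/setP => j.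
apply/idP/idP => /corner_edge_mem Fj; apply/corner_edge_mem; last by rewrite FSS'.
by rewrite -FSS'.
Qed.

Lemma corner_expand y : y = x + \sum_j dot (y - x) (u j) *: delta j.
Proof. by rewrite -(corner_span cornerF (y - x)) addrC subrK. Qed.

Lemma corner_expand_face S y : F S y ->
  y = x + \sum_(k : {j | j \in S}) dot (y - x) (u (val k)) *: delta (val k).
Proof.
move=> /(corner_face cornerF)[Py y0]; rewrite {1}[y]corner_expand; congr (_ + _).
rewrite -(big_sub (mem S) (fun j => dot (y - x) (u j) *: delta j)) [RHS]big_mkcond /=.
by apply: eq_bigr => j _; case: ifPn => // /y0 ->; rewrite scale0r.
Qed.

Lemma corner_dim S : has_dim (F S) #|S|.
Proof.
have -> : #|S| = \rank (\matrix_(k < #|{: {j | j \in S}}|) delta (val (enum_val k))).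
  rewrite (rank_biorthogonal (e := fun k : {j | j \in S} => delta (val k))
    (w := fun k => u (val k))).
    by rewrite card_sig.
  by move=> k l; rewrite (corner_dual cornerF).
apply: (has_dim_span (e := fun k : {j | j \in S} => delta (val k)) (corner_apex_mem S)).
  by move=> k; apply/corner_edge_mem; exact: valP.
move=> y Fy; exists (fun k => dot (y - x) (u (val k))); exact: corner_expand_face.
Qed.

Lemma corner_exposed c : (forall y, P y -> dot y c <= dot x c) <->
  forall j, dot (delta j) c <= 0.
Proof.
split=> [Pc j|dc y Py].
  have := Pc _ (corner_sub (corner_edge cornerF j)); rewrite dotDl.
  by rewrite gerDl.
rewrite [y]corner_expand dotDl dot_suml gerDl; apply: sumr_le0 => j _.
by rewrite dotZl mulr_ge0_le0 // (corner_ge0 cornerF).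
Qed.

(** On the cone at x the functional c is a combination of the coordinates with
    coefficients [dot (delta j) c] <= 0, so it attains its maximum where the
    coordinates with a nonzero coefficient vanish. *)
Lemma corner_exposed_face c : (forall j, dot (delta j) c <= 0) ->
  P `&` [set y | dot y c = dot x c] = F [set j | dot (delta j) c == 0]%SET.
Proof.
move=> dc; apply/seteqP; split=> y.
  move=> [Py /= yc]; apply/(corner_face cornerF); split=> // j; rewrite inE => jc.
  have s0 : \sum_j dot (y - x) (u j) * - dot (delta j) c = 0.
    under eq_bigr do rewrite mulrN -dotZl.
    by rewrite sumrN -dot_suml -(corner_span cornerF) dotBl yc subrr oppr0.
  have ge0 i : true -> 0 <= dot (y - x) (u i) * - dot (delta i) c.
    by move=> _; rewrite mulr_ge0 ?oppr_ge0 // (corner_ge0 cornerF).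
  have /eqP := psumr_eq0P ge0 s0 (i := j) isT.
  by rewrite mulf_eq0 oppr_eq0 (negPf jc) orbF => /eqP.
move=> /(corner_face cornerF)[Py y0]; split=> //=.
rewrite [y]corner_expand dotDl dot_suml big1 ?addr0 // => j _; rewrite dotZl.
have [->|jc] := eqVneq (dot (delta j) c) 0; first by rewrite mulr0.
by rewrite y0 ?mul0r // inE.
Qed.

Variables (d : nat) (A : 'M[R]_(m, d.+1)).

(** The sign turns functionals that are maximal at x into functionals that are
    nonnegative on the configuration, as in [exposes]. *)
Definition corner_vectors j : 'rV[R]_d.+1 := - proj A (delta j).
Let p := corner_vectors.

Lemma dot_corner_vectors j c : dot (p j) c = - dot (delta j) (A *m c).
Proof. by rewrite dotNl dot_mul. Qed.

(** A functional on the target exposes F S from below if and only if its pullback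
    vanishes on the edge directions in S and is negative on the others. *)
Lemma corner_shadow S : S != finset.setT ->
  shadow_face A P (F S) <-> cone_face p S.
Proof.
move=> ST; split=> [[c [b [Pc FE]]]|[c [_ c0 cp]]].
  have xb : dot x (A *m c) = b.
    by have := corner_apex_mem S; rewrite FE => -[_ /=]; rewrite dot_mul.
  have dc : forall j, dot (delta j) (A *m c) <= 0.
    by apply/corner_exposed => y Py; rewrite xb -dot_mul; exact: Pc.
  have ES : S = [set j | dot (delta j) (A *m c) == 0]%SET.
    apply: corner_inj; rewrite -(corner_exposed_face dc) FE xb.
    by apply/seteqP; split=> y [Py /=]; rewrite dot_mul.
  apply: (cone_faceI (c := c) ST) => j; rewrite dot_corner_vectors ES inE.
    by move=> /eqP ->; rewrite oppr0.
  by move=> jc; rewrite oppr_gt0 lt_neqAle jc dc.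
have dc j : dot (delta j) (A *m c) <= 0.
  rewrite -oppr_ge0 -dot_corner_vectors.
  by have [/c0 ->//|/cp/ltW] := boolP (j \in S).
exists c, (dot x (A *m c)); split=> [y Py|].
  by rewrite dot_mul; exact: (corner_exposed _).2 dc y Py.
have -> : S = [set j | dot (delta j) (A *m c) == 0]%SET.
  apply/setP => j; rewrite inE -oppr_eq0 -dot_corner_vectors.
  have [/c0 ->|/cp/gt_eqF ->//] := boolP (j \in S); by rewrite eqxx.
rewrite -(corner_exposed_face dc).
by apply/seteqP; split=> y [Py /=]; rewrite dot_mul.
Qed.

Hypothesis genA : generic_projection A P.
Hypothesis rankA : \rank A = d.+1.
Hypothesis faceF : forall S, is_face P (F S).

(** For more than d edges genericity makes the span of their directions meet the
    kernel of A in codimension d + 1, so their images generate the target. *)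
Lemma corner_general_position : general_position p.
Proof.
move=> T c ltT cT; pose D := \matrix_(k < #|{: {j | j \in T}}|) delta (val (enum_val k)).
have rD : \rank D = #|T|.
  rewrite (rank_biorthogonal (e := fun k : {j | j \in T} => delta (val k))
    (w := fun k => u (val k))) ?card_sig //.
  by move=> k l; rewrite (corner_dual cornerF).
have rDA : \rank (D *m A) = d.+1.
  have := @genA _ D; rewrite mxrank_ker rankA rD => H.
  have := mxrank_mul_ker D A; rewrite H ?rD; last first.
    move=> i; exists (F [set val (enum_val i)]%SET), x, (x + delta (val (enum_val i))).
    split; last by rewrite rowK addrC addKr.
    - by split=> //; have := corner_dim [set val (enum_val i)]%SET; rewrite cards1.
    - exact: corner_apex_mem.
    - exact: (corner_edge cornerF).
  have := rank_leq_row A; rewrite rankA => ltm.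
  have : (#|T| <= m)%N by rewrite -rD rank_leq_col.
  clear -ltT ltm; move: (\rank _) (#|T|) ltT => a t; lia.
have /row_freeP[B DAB] : row_free (D *m A)^T by rewrite /row_free mxrank_tr rDA.
have DAc : (D *m A) *m c = 0.
  apply/matrixP => i j; rewrite ord1 [RHS]mxE.
  have /eqP := cT _ (valP (enum_val i)); rewrite dotNl oppr_eq0 => /eqP <-.
  rewrite /dot /proj !mxE; apply: eq_bigr => l _; congr (_ * _).
  by rewrite !mxE; apply: eq_bigr => o _; rewrite !mxE.
apply: trmx_inj; rewrite trmx0 -[c^T]mulmx1 -DAB mulmxA -trmx_mul DAc trmx0.
by rewrite mul0mx.
Qed.

Hypothesis ltdJ : (d < #|J|)%N.

(** S extends to a facet of the configuration, whose frame shows that the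
    projected directions in S are independent. *)
Lemma corner_proj_dim S : cone_face p S -> has_dim (proj A @` F S) #|S|.
Proof.
move=> fS; have [T [c eT] [ST cT]] := exists_cone_facet corner_general_position ltdJ fS.
have [w [_ _ pw _]] := exists_frame corner_general_position ltdJ eT cT.
pose e (k : {j | j \in S}) := proj A (delta (val k)).
have -> : #|S| = \rank (\matrix_(k < #|{: {j | j \in S}}|) e (enum_val k)).
  rewrite (rank_biorthogonal (e := e) (w := fun k => - w (val k))).
    by rewrite card_sig.
  move=> k l; rewrite dotNr -dotNl -[- e k]/(p (val k)) pw //; apply: fintype.subsetP ST _ _;
    exact: valP.
apply: (has_dim_span (x := proj A x)).
- by exists x => //; exact: corner_apex_mem.
- move=> k; exists (x + delta (val k)); last by rewrite /proj mulmxDl.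
  by apply/corner_edge_mem; exact: valP.
- move=> _ [y Fy <-]; exists (fun k => dot (y - x) (u (val k))).
  rewrite {1}(corner_expand_face Fy) /proj mulmxDl mulmx_suml; congr (_ + _).
  by apply: eq_bigr => k _; rewrite scalemxAl.
Qed.

Lemma corner_proj_full : has_dim (proj A @` P) d.+1.
Proof.
pose e j := proj A (delta j).
have rk : \rank (\matrix_(j < #|J|) e (enum_val j)) = d.+1.
  set D := \matrix_j _; rewrite -mxrank_tr; apply/eqP; apply: inj_row_free => w wD.
  apply: trmx_inj; rewrite trmx0; apply: (corner_general_position (T := finset.setT)).
    by rewrite cardsT.
  move=> j _; rewrite dotNl; have : (w *m D^T)^T = 0 by rewrite wD trmx0.
  rewrite trmx_mul trmxK => /matrixP/(_ (enum_rank j) 0); rewrite [RHS]mxE.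
  rewrite mxE => wj; apply/eqP; rewrite oppr_eq0 dotE -[X in _ == X]wj; apply/eqP.
  by apply: eq_bigr => i _; rewrite !mxE enum_rankK.
suff: has_dim (proj A @` P) (\rank (\matrix_(j < #|J|) e (enum_val j))) by rewrite rk.
apply: (has_dim_span (x := proj A x)).
- by exists x => //; exact: corner_sub (corner_apex cornerF).
- move=> j; exists (x + delta j); last by rewrite /proj mulmxDl.
  exact: corner_sub (corner_edge cornerF j).
- move=> _ [y Py <-]; exists (fun j => dot (y - x) (u j)).
  rewrite {1}[y]corner_expand /proj mulmxDl mulmx_suml; congr (_ + _).
  by apply: eq_bigr => j _; rewrite scalemxAl.
Qed.

End CornerShadow.

(** * The face lattice of a polygon as a finite structure *)

Lemma card_fset_set_finite (T : finType) (K : choiceType) (A : set K) (h : T -> K)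
    (B : {set T}) : {in B &, injective h} -> A = h @` [set` B] ->
  #|` fset_set A| = #|B|.
Proof.
move=> hinj ->; have -> : fset_set (h @` [set` B]) = [fset h x | x in B]%fset.
  apply/fsetP => k; rewrite in_fset_set; last exact/finite_image/finite_finset.
  apply/idP/imfsetP => [|[x /= xB ->]]; rewrite inE /=; last by exists x.
  by case=> x xB <-; exists x.
by rewrite card_in_imfset //= ?cardE // => x y; rewrite -?mem_enum; exact: hinj.
Qed.

Section PolygonModel.
Variables (R : realType) (n : nat) (Pn : set 'rV[R]_2).
Hypothesis ngon : is_ngon n Pn.

Definition nonempty_faces : set (set 'rV[R]_2) := [set F | is_face Pn F /\ F !=set0].

(** The nonempty faces of the polygon as a finite type; the functions from the
    components to it index the nonempty faces of the product. *)
Definition faceT : finType := fset_set nonempty_faces.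
Definition face_of (t : faceT) : set 'rV[R]_2 := val t.
Definition le_face (s t : faceT) : bool := `[< face_of s `<=` face_of t >].
Definition vt_face (t : faceT) : bool := `[< has_dim (face_of t) 0 >].

Let finite_nonempty : finite_set nonempty_faces.
Proof.
have [[/polytope_vertices[s [v PE]] _] _] := ngon.
apply: (@sub_finite_set _ _ (faces Pn)) => [F []//|].
by rewrite PE; exact: finite_faces.
Qed.

Lemma face_ofP t : is_face Pn (face_of t) /\ face_of t !=set0.
Proof. by have := valP t; rewrite in_fset_set // inE. Qed.

Lemma face_of_onto F : is_face Pn F -> F !=set0 -> exists t, face_of t = F.
Proof.
move=> faceF F0; have FF : F \in fset_set nonempty_faces by rewrite in_fset_set // inE.
by exists [` FF]%fset.
Qed.

Lemma face_of_inj : injective face_of.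
Proof. exact: val_inj. Qed.

Lemma le_faceP s t : reflect (face_of s `<=` face_of t) (le_face s t).
Proof. exact: asboolP. Qed.

Lemma vt_faceP t : reflect (exists x, face_of t = [set x]) (vt_face t).
Proof.
apply: (iffP (asboolP _)) => [/has_dim0P//|[x ->]]; exact: has_dim_set1.
Qed.

(** The last clause keeps each edge at a vertex of the product outside the facet
    spanned by the other edges there, as [exists_corner] requires. *)
Lemma polygon_structure : exists (top : faceT) (star : faceT -> bool -> faceT),
  [/\ face_of top = Pn, polygon_lattice le_face vt_face top star n
    & forall v b, vt_face v -> ~~ le_face (star v b) (star v (~~ b))].
Proof.
have [dimP nP] := ngon.
have [] := @face_of_onto Pn; [|exact: polygon_nonempty|move=> top topE].
  exists 0, 0; split=> [x _|]; first by rewrite mulmx0 mxE.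
  by apply/seteqP; split=> [x Px|x []//]; split=> //=; rewrite mulmx0 mxE.
have edgeP t : is_edge vt_face top t -> proper_edge Pn (face_of t).
  move=> /andP[/asboolPn tdim tt]; have [ft t0] := face_ofP t.
  by split=> // tP; case/eqP: tt; apply: face_of_inj; rewrite topE.
have edgeP' t : proper_edge Pn (face_of t) -> is_edge vt_face top t.
  move=> [_ _ tdim tP]; apply/andP; split; first exact/asboolPn.
  by apply/eqP => tt; apply: tP; rewrite tt topE.
have star_ex v : exists e : bool -> faceT, vt_face v ->
    [/\ e false != e true, forall b, is_edge vt_face top (e b) /\ le_face v (e b)
      & forall t, is_edge vt_face top t -> le_face v t -> exists b, t = e b].
  have [/vt_faceP[x vx]|_] := boolP (vt_face v); last by exists (fun=> v).
  have [|E1 [E2 [[E12 e1 e2 [E1x E2x]] Eall]]] := vertex_edges dimP (x := x).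
    by rewrite -vx; have [] := face_ofP v.
  have [[f1 n1 _ _] [f2 n2 _ _]] := (e1, e2).
  have [t1 t1E] := face_of_onto f1 n1; have [t2 t2E] := face_of_onto f2 n2.
  exists (fun b => if b then t2 else t1) => _; split.
  - by apply/eqP => t12; apply: E12; rewrite -t1E -t2E t12.
  - move=> b; split; first by apply: edgeP'; case: b; rewrite ?t1E ?t2E.
    by apply/le_faceP; rewrite vx => y ->; case: b; rewrite ?t1E ?t2E.
  - move=> t /edgeP et /le_faceP; rewrite vx => /(_ x erefl) /(Eall _ et)[tE|tE].
      by exists false; apply: face_of_inj; rewrite tE t1E.
    by exists true; apply: face_of_inj; rewrite tE t2E.
have /choice[star starP] := star_ex.
exists top, star; split=> // [|v b vv].
  split.
  - by move=> t; apply/le_faceP; rewrite topE; have [[c [b [_ ->]]] _] := face_ofP t => x [].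
  - move=> v w /vt_faceP[x vx] /vt_faceP[y wy]; apply/le_faceP/eqP => [|->//].
    by rewrite vx wy => /(_ y erefl) /= yx; apply: face_of_inj; rewrite vx wy yx.
  - by apply/asboolPn; rewrite topE; exact: polygon_not_vertex.
  - rewrite -nP /nfaces -[LHS]cardsE; symmetry; apply: (card_fset_set_finite (h := face_of)).
      by move=> s t _ _ /face_of_inj.
    apply/seteqP; split=> [F [fF F0]|_ [t /=] + <-].
      have [t tE] := face_of_onto fF (has_dim_nonempty F0).
      by exists t => //=; rewrite !inE tE.
    by rewrite !inE => tdim; split=> //; have [] := face_ofP t.
  - move=> t /edgeP/(edge_vertices dimP)[x [y [[xy fx fy [tx ty]] all_xy]]].
    have [vx vxE] := face_of_onto fx (ex_intro _ x erefl).
    have [vy vyE] := face_of_onto fy (ex_intro _ y erefl).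
    have vxy : vx != vy.
      by apply: contraNneq xy => vxy; move: vxE; rewrite vxy vyE => /seteqP[/(_ y erefl) /= ->].
    rewrite -[LHS]cardsE -(_ : #|[set vx; vy]%SET| = 2%N); last by rewrite cards2 vxy.
    apply: eq_card => v; rewrite !inE; apply/andP/orP.
      case=> /vt_faceP[z vz] /le_faceP; rewrite vz => /(_ z erefl) /all_xy [|zx|zy].
      + by rewrite -vz; have [] := face_ofP v.
      + by left; apply/eqP/face_of_inj; rewrite vz zx.
      + by right; apply/eqP/face_of_inj; rewrite vz zy.
    case=> /eqP ->; split; first by apply/vt_faceP; exists x.
    + by apply/le_faceP; rewrite vxE => z ->.
    + by apply/vt_faceP; exists y.
    + by apply/le_faceP; rewrite vyE => z ->.
  - by move=> v b /starP[_ /(_ b)[]].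
  - by move=> v b /starP[_ /(_ b)[]].
  - by move=> v /starP[].
  - move=> v t vv vt; have [_ _ allb] := starP v vv.
    have [/vt_faceP[y ty]|tv] := boolP (vt_face t).
      apply: Or31; have /vt_faceP[x vx] := vv; apply: face_of_inj.
      by have /le_faceP := vt; rewrite vx ty => /(_ x erefl) /= ->.
    have [->|tt] := eqVneq t top; first exact: Or33.
    by apply: Or32; apply: allb => //; apply/andP.
have [neq starb _] := starP v vv; apply/negP => /le_faceP sub.
have eE := edge_incl (edgeP _ (starb b).1) (edgeP _ (starb (~~ b)).1) sub.
by move/face_of_inj: eE neq; case: b {sub} => /= ->; rewrite eqxx.
Qed.

End PolygonModel.

(** * The faces of the projected product *)

Lemma is_face_set0 (R : realType) m (P : set 'rV[R]_m) : is_face P set0.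
Proof.
exists 0, 1; split=> [x _|]; first by rewrite mulmx0 mxE ler01.
apply/seteqP; split=> // x [_ /=]; rewrite mulmx0 mxE => /esym/eqP.
by rewrite oner_eq0.
Qed.

Lemma rank_last_coords (R : realType) m k : (k <= m)%N -> \rank (last_coords R m k) = k.
Proof.
move=> km; apply/eqP; rewrite eqn_leq rank_leq_col /=.
have AA : (last_coords R m k)^T *m last_coords R m k = 1%:M.
  apply/matrixP => i j; rewrite !mxE.
  have lti : (m - k + i < m)%N by have := ltn_ord i; lia.
  rewrite (bigD1 (Ordinal lti)) //= big1 => [|l li]; rewrite !mxE /= ?eqxx.
    rewrite addr0 mul1r; congr (_%:R); congr nat_of_bool.
    by rewrite eqn_add2l.
  by rewrite -[_ == _ :> nat]/(l == Ordinal lti) (negPf li) mul0r.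
by rewrite -[X in (X <= _)%N](mxrank1 R) -AA mxrankM_maxr.
Qed.

Section Realization.
Variables (R : realType) (r n : nat) (Pn : set 'rV[R]_2).
Variables (phi : set 'rV[R]_(r * 2) -> set 'rV[R]_(r * 2)) (P : set 'rV[R]_(r * 2)).
Hypotheses (r2 : (1 < r)%N) (n4 : (3 < n)%N) (pp : projectable_product n Pn phi P).
Variables (top : faceT Pn) (star : faceT Pn -> bool -> faceT Pn).
Hypotheses (topE : face_of top = Pn)
  (lat : polygon_lattice (@le_face _ Pn) (@vt_face _ Pn) top star n)
  (star_incomparable : forall v b, vt_face v -> ~~ le_face (star v b) (star v (~~ b))).

Notation prod_face := {ffun 'I_r -> faceT Pn}.
Notation J := ('I_r * bool)%type.
Implicit Types (g v : prod_face) (S : {set J}).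
Let A := last_coords R (r * 2) 4.
Let Pr := prod_set (fun _ : 'I_r => Pn).

Definition real_face g : set 'rV[R]_(r * 2) := phi (prod_set (fun i => face_of (g i))).

Let ngonP := factor_ngon pp.

Lemma prod_face_of_nonempty g : prod_set (fun i => face_of (g i)) !=set0.
Proof.
have /choice[y yP] i : exists y, face_of (g i) y by exact: (face_ofP ngonP (g i)).2.
by exists (assemble y) => i; rewrite -/(component i _) component_assemble.
Qed.

Lemma prod_face_of_face g : faces Pr (prod_set (fun i => face_of (g i))).
Proof. by apply: prod_set_face => i; have [] := face_ofP ngonP (g i). Qed.

Let phi_mono F G : faces Pr F -> faces Pr G -> (F `<=` G <-> phi F `<=` phi G).
Proof. exact: (realization_iso pp).2. Qed.

Lemma real_face_face g : is_face P (real_face g).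
Proof.
have [[phi_fun _ _] _] := realization_iso pp.
exact/phi_fun/prod_face_of_face.
Qed.

(** An isomorphism of lattices preserves the least element. *)
Lemma phi_set0 : phi set0 = set0.
Proof.
have [[_ _ phi_surj] _] := realization_iso pp.
have [F faceF phiF] := phi_surj _ (is_face_set0 P).
apply/seteqP; split=> // x; rewrite -{2}phiF; apply: (phi_mono _ _).1 => //.
exact: is_face_set0.
Qed.

Lemma real_face_nonempty g : real_face g !=set0.
Proof.
have [x gx] := prod_face_of_nonempty g; apply/set0P/eqP => g0.
suff : prod_set (fun i => face_of (g i)) `<=` set0 by move/(_ x gx).
apply/phi_mono; rewrite ?phi_set0; [exact: prod_face_of_face|exact: is_face_set0|].
by rewrite -/(real_face g) g0.
Qed.

Lemma real_face_sub g g' : real_face g `<=` real_face g' <-> forall i, le_face (g i) (g' i).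
Proof.
rewrite -phi_mono; try exact: prod_face_of_face.
rewrite prod_set_sub => [|i]; last by have [] := face_ofP ngonP (g i).
by split=> H i; apply/le_faceP; apply: H.
Qed.

Lemma real_face_inj : injective real_face.
Proof.
move=> g g' gg'; apply/ffunP => i; apply: face_of_inj; apply/seteqP.
by split; apply/le_faceP; apply: (real_face_sub _ _).1; rewrite gg'.
Qed.

Lemma real_face_onto F : is_face P F -> F !=set0 -> exists g, F = real_face g.
Proof.
have [[_ _ phi_surj] _] := realization_iso pp.
move=> faceF [x Fx]; have [F' faceF' F'F] := phi_surj _ faceF.
have F'0 : F' !=set0.
  by apply/set0P/eqP => F'0; move: Fx; rewrite -F'F F'0 phi_set0.
have [G [GP F'G]] := prod_set_face_inv faceF' F'0.
have /choice[t tG] i := face_of_onto ngonP (GP i).1 (GP i).2.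
exists [ffun i => t i]; rewrite -F'F F'G; congr (phi (prod_set _)).
by apply: funext => i; rewrite ffunE tG.
Qed.

Definition vertex_face v S := real_face (join_edges top star v S).

Lemma exists_vertex_corner v : all_vt (@vt_face _ Pn) v ->
  exists x delta u, corner P (vertex_face v) x delta u.
Proof.
move=> vtv; have vtvi i : vt_face (v i) := forallP vtv i.
apply: exists_corner.
- by rewrite card_prod card_ord card_bool.
- by move=> S; exact: real_face_face.
- move=> S S' SS'; apply/real_face_sub => i; rewrite !ffunE.
  have i0 := fintype.subsetP SS' (i, false); have i1 := fintype.subsetP SS' (i, true).
  have vtop := lattice_le_top lat.
  have vstar b : le_face (v i) (star (v i) b) by exact: (lattice_star_le lat).
  have refl t : le_face t t by apply/le_faceP.
  case: ((i, false) \in S) i0 => [/(_ isT) ->|_]; case: ((i, true) \in S) i1 => [/(_ isT) ->|_];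
    repeat case: ifP => _; by rewrite ?refl ?vtop ?vstar.
- exact: real_face_nonempty.
- move=> [i b] /real_face_sub /(_ i).
  have := star_incomparable b (vtvi i); rewrite !ffunE !inE !xpair_eqE !eqxx /=.
  by case: b => /= /le_faceP.
Qed.

Definition is_shadow g : bool := `[< shadow_face A P (real_face g) >].

(** The survival of the vertices, edges and polygons provides the faces of the
    configuration at v from which the numbers [local_count] are computed. *)
Lemma local_counts v : all_vt (@vt_face _ Pn) v -> exists k : nat -> nat -> nat,
  [/\ forall a b, (b + a.*2 < 4)%N ->
        #|[set S | [&& is_shadow (join_edges top star v S),
                    num_both S == a & num_single S == b]]%SET| = k a b,
      k 0 0 = 1, k 0 1 = 2 * r, k 1 0 = r
    & [/\ k 0 2 + 6 = 5 * r, k 1 1 = 2 * r & k 0 3 + 4 = 2 * r]]%N.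
Proof.
move=> vtv; have [x [delta [u cor]]] := exists_vertex_corner vtv.
have cJ : #|{: J}| = (r * 2)%N by rewrite card_prod card_ord card_bool.
have rkA : \rank A = 4 by apply: rank_last_coords; lia.
have faceF S : is_face P (vertex_face v S) by exact: real_face_face.
have gp := corner_general_position cor (realization_generic pp) rkA faceF.
have small S : (#|S| < 4)%N -> S != finset.setT.
  by move=> cS; apply: contraTneq cS => ->; rewrite cardsT cJ; lia.
have shadowE S : (#|S| < 4)%N ->
    is_shadow (join_edges top star v S) = `[< cone_face (corner_vectors delta A) S >].
  by move=> cS; apply/asboolP/asboolP => /(corner_shadow cor A (small S cS)).
have dimS := corner_dim cor.
have f0 : cone_face (corner_vectors delta A) finset.set0.
  apply/(corner_shadow cor); first by apply: small; rewrite cards0.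
  apply: survives_shadow; apply: (vertices_survive pp); split=> //.
  by have := dimS finset.set0; rewrite cards0.
have f1 j : cone_face (corner_vectors delta A) [set j]%SET.
  apply/(corner_shadow cor); first by apply: small; rewrite cards1.
  apply: survives_shadow; apply: (edges_survive pp); split=> //.
  by have := dimS [set j]%SET; rewrite cards1.
have f2 i : cone_face (corner_vectors delta A) (edge_pair i).
  apply/(corner_shadow cor); first by apply: small; rewrite card_pair.
  apply: survives_shadow; apply: (polygons_survive pp).
  exists i, (fun j => face_of (v j)); split=> [j|].
    by split; [have [] := face_ofP ngonP (v j)|apply/asboolP; exact: (forallP vtv j)].
  congr prod_set; apply: funext => j; rewrite ffunE !inE !xpair_eqE !andbT !andbF orbF.
  by case: eqVneq => _ //=; rewrite topE.
exists (local_count (corner_vectors delta A)); split.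
- move=> a b ab; apply: eq_card => S; rewrite !inE.
  case: (num_both S =P a) => [Sa|]; last by rewrite ?andbF.
  case: (num_single S =P b) => [Sb|]; last by rewrite ?andbF.
  by rewrite !andbT shadowE // card_num Sa Sb.
- exact: local_count00.
- exact: local_count01.
- exact: local_count10.
- by split; [exact: local_count02|exact: local_count11|exact: local_count03].
Qed.

Lemma exists_vertex_below g : exists2 v, all_vt (@vt_face _ Pn) v &
  forall i, le_face (v i) (g i).
Proof.
have /choice[v vP] i : exists t, vt_face t /\ le_face t (g i).
  have [vg|vg] := boolP (vt_face (g i)).
    by exists (g i); split=> //; apply/le_faceP.
  have [gt|gt] := eqVneq (g i) top.
    have : (0 < #|[pred t | @vt_face _ Pn t]|)%N by rewrite (lattice_card_vt lat); lia.
    by case/card_gt0P => t vt; exists t; rewrite gt (lattice_le_top lat).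
  have : (0 < #|[pred t | vt_face t && le_face t (g i)]|)%N.
    by rewrite (lattice_card_edge lat) // /is_edge vg.
  by case/card_gt0P => t /andP[]; exists t.
exists [ffun i => v i] => [|i]; last by rewrite ffunE (vP i).2.
by apply/forallP => i; rewrite ffunE (vP i).1.
Qed.

Let Q := proj A @` P.

Lemma corner_at g : exists v x delta u S, [/\ all_vt (@vt_face _ Pn) v,
  corner P (vertex_face v) x delta u & g = join_edges top star v S].
Proof.
have [v vtv vg] := exists_vertex_below g.
have [x [delta [u cor]]] := exists_vertex_corner vtv.
by have [S gS] := join_edges_onto lat vtv vg; exists v, x, delta, u, S.
Qed.

Definition num_dim g := (num_edge (@vt_face _ Pn) top g + (num_top top g).*2)%N.

Lemma num_dim_join v S : all_vt (@vt_face _ Pn) v ->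
  num_dim (join_edges top star v S) = #|S|.
Proof.
by move=> vtv; rewrite /num_dim (num_edge_join lat vtv) (num_top_join lat vtv) card_num.
Qed.

Let rkA : \rank A = 4.
Proof. by apply: rank_last_coords; lia. Qed.

Let cJ : #|{: J}| = (r * 2)%N.
Proof. by rewrite card_prod card_ord card_bool. Qed.

Let ltJ : (3 < #|{: J}|)%N.
Proof. by rewrite cJ; lia. Qed.

Let faceF v S : is_face P (vertex_face v S).
Proof. exact: real_face_face. Qed.

Lemma proj_dim4 : has_dim Q 4.
Proof.
have [v [x [delta [u [S [vtv cor _]]]]]] := corner_at [ffun=> top].
exact: (corner_proj_full cor (realization_generic pp) rkA (faceF v) ltJ).
Qed.

Lemma shadow_dim g : is_shadow g -> (num_dim g < 4)%N ->
  has_dim (proj A @` real_face g) (num_dim g).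
Proof.
have [v [x [delta [u [S [vtv cor ->]]]]]] := corner_at g.
rewrite num_dim_join // => /asboolP shS cS.
have ST : S != finset.setT by apply: contraTneq cS => ->; rewrite cardsT cJ; lia.
apply: (corner_proj_dim cor (realization_generic pp) rkA (faceF v) ltJ).
exact/(corner_shadow cor).
Qed.

(** Such a face is spanned by a proper subset of the edges at a vertex, and these
    are the proper faces of a configuration in general position. *)
Lemma shadow_small g : is_shadow g -> real_face g <> P -> (num_dim g < 4)%N.
Proof.
have [v [x [delta [u [S [vtv cor ->]]]]]] := corner_at g.
rewrite num_dim_join // => /asboolP shS gP.
have gp := corner_general_position cor (realization_generic pp) rkA (faceF v).
apply: (card_cone_face gp); apply/(corner_shadow cor) => //.
apply/eqP => ST; apply: gP; apply/seteqP; split=> y.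
  by move=> /(corner_face cor)[].
by move=> Py; apply/(corner_face cor); split=> // j; rewrite ST inE.
Qed.

(** A face of the image of dimension less than 4 comes from a surviving face other
    than P, and the projection keeps the dimension of these. *)
Lemma dfaces_proj d : (d < 4)%N -> dfaces d Q =
  (fun g => proj A @` real_face g) @` [set` [set g | is_shadow g & num_dim g == d]%SET].
Proof.
move=> d4; apply/seteqP; split=> [H [faceH dimH]|_ [g /=] + <-].
  have [X shX HX] := face_proj_shadow faceH.
  have [_ [y Xy _]] : (proj A @` X) !=set0 by rewrite -HX; exact: has_dim_nonempty dimH.
  have [g gX] := real_face_onto (shadow_face_is_face shX) (ex_intro _ y Xy).
  have shg : is_shadow g by apply/asboolP; rewrite -gX.
  exists g; last by rewrite HX gX.
  have gP : real_face g <> P.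
    move=> gP; move: d4; rewrite (has_dim_uniq dimH (_ : has_dim H 4)) //.
    by rewrite HX gX gP; exact: proj_dim4.
  have := shadow_dim shg (shadow_small shg gP); rewrite -gX -HX => dimH'.
  by rewrite /= inE shg (has_dim_uniq dimH' dimH) eqxx.
rewrite inE => /andP[shg /eqP gd]; split.
  by apply: shadow_face_proj; exact/asboolP.
by rewrite -gd; apply: shadow_dim; rewrite // gd.
Qed.

Lemma nfaces_proj d : (d < 4)%N ->
  nfaces d Q = #|[set g | is_shadow g & num_dim g == d]%SET|.
Proof.
move=> d4; apply: (card_fset_set_finite _ (dfaces_proj d4)) => g g'.
rewrite !inE => /andP[/asboolP shg _] /andP[/asboolP shg' _] gg'.
exact/real_face_inj/(shadow_face_inj shg shg').
Qed.

Definition shadow_count a b :=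
  #|[set g | [&& is_shadow g, num_top top g == a
                & num_edge (@vt_face _ Pn) top g == b]]%SET|.

Lemma shadow_countE a b k : (b + a.*2 < 4)%N ->
  (forall v, all_vt (@vt_face _ Pn) v ->
    #|[set S | [&& is_shadow (join_edges top star v S),
                   num_both S == a & num_single S == b]]%SET| = k) ->
  (n ^ a * 2 ^ b * shadow_count a b = n ^ r * k)%N.
Proof.
move=> ab local; apply: (double_count lat) => [g /and3P[_ /eqP -> /eqP ->] //|v vtv].
rewrite -(local v vtv); apply: eq_card => S; rewrite !inE.
by rewrite (num_edge_join lat vtv) (num_top_join lat vtv).
Qed.

Lemma shadow_counts : [/\ shadow_count 0 0 = n ^ r, shadow_count 0 1 = r * n ^ r,
  n * shadow_count 1 0 = r * n ^ r,
  4 * shadow_count 0 2 + 6 * n ^ r = 5 * r * n ^ r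
  & n * shadow_count 1 1 = r * n ^ r /\
    8 * shadow_count 0 3 + 4 * n ^ r = 2 * r * n ^ r]%N.
Proof.
have count a b k : (b + a.*2 < 4)%N -> (forall f : nat -> nat -> nat,
    [/\ f 0 0 = 1, f 0 1 = 2 * r, f 1 0 = r
      & [/\ f 0 2 + 6 = 5 * r, f 1 1 = 2 * r & f 0 3 + 4 = 2 * r]]%N -> f a b = k) ->
    (n ^ a * 2 ^ b * shadow_count a b = n ^ r * k)%N.
  move=> ab fk; apply: shadow_countE => // v /local_counts[f [fE f00 f01 f10 f3]].
  by rewrite fE //; apply: fk.
have c00 := @count 0%N 0%N 1%N isT (fun f fP => let: And4 e _ _ _ := fP in e).
have c01 := @count 0%N 1%N (2 * r)%N isT (fun f fP => let: And4 _ e _ _ := fP in e).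
have c10 := @count 1%N 0%N r isT (fun f fP => let: And4 _ _ e _ := fP in e).
have c11 := @count 1%N 1%N (2 * r)%N isT (fun f fP => let: And4 _ _ _ (And3 _ e _) := fP in e).
have [k2 k2E] : exists k, (k + 6 = 5 * r)%N by exists (5 * r - 6)%N; lia.
have [k3 k3E] : exists k, (k + 4 = 2 * r)%N by exists (2 * r - 4)%N; lia.
have c02 : (n ^ 0 * 2 ^ 2 * shadow_count 0 2 = n ^ r * k2)%N.
  by apply: count => // f [_ _ _ [h _ _]]; lia.
have c03 : (n ^ 0 * 2 ^ 3 * shadow_count 0 3 = n ^ r * k3)%N.
  by apply: count => // f [_ _ _ [_ _ h]]; lia.
move: c00 c01 c10 c11 c02 c03; rewrite !expn0 !expn1 !mul1n !muln1.
move: (n ^ r)%N => N c00 c01 c10 c11 c02 c03.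
have k2N : (N * k2 + 6 * N = 5 * r * N)%N by rewrite -k2E; lia.
have k3N : (N * k3 + 4 * N = 2 * r * N)%N by rewrite -k3E; lia.
by split; [|lia|lia|lia|split; lia].
Qed.

Lemma nfaces_counts : [/\ nfaces 0 Q = shadow_count 0 0,
  nfaces 1 Q = shadow_count 0 1,
  nfaces 2 Q = (shadow_count 1 0 + shadow_count 0 2)%N
  & nfaces 3 Q = (shadow_count 1 1 + shadow_count 0 3)%N].
Proof.
split; rewrite nfaces_proj //.
- apply: eq_card => g; rewrite !inE /num_dim; congr (_ && _).
  by apply/eqP/andP => [|[/eqP ? /eqP ?]]; lia.
- apply: eq_card => g; rewrite !inE /num_dim; congr (_ && _).
  by apply/eqP/andP => [|[/eqP ? /eqP ?]]; lia.
- rewrite -(cardsID [set g | num_top top g == 1%N]%SET); congr (_ + _)%N;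
    apply: eq_card => g; rewrite !inE /num_dim; case: is_shadow; rewrite ?andbF //=.
    by apply/andP/andP => [[/eqP ? /eqP ?]|[/eqP ? /eqP ?]]; split; lia.
  by apply/andP/andP => [[/eqP ? /eqP ?]|[/eqP ? /eqP ?]]; split; lia.
- rewrite -(cardsID [set g | num_top top g == 1%N]%SET); congr (_ + _)%N;
    apply: eq_card => g; rewrite !inE /num_dim; case: is_shadow; rewrite ?andbF //=.
    by apply/andP/andP => [[/eqP ? /eqP ?]|[/eqP ? /eqP ?]]; split; lia.
  by apply/andP/andP => [[/eqP ? /eqP ?]|[/eqP ? /eqP ?]]; split; lia.
Qed.

End Realization.

(** * The f-vector and the fatness *)

(** Multiplication by 4 keeps the last two entries within the natural numbers. *)
Lemma projection_f_vector (R : realType) (r n : nat) (Pn : set 'rV[R]_2)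
    (phi : set 'rV[R]_(r * 2) -> set 'rV[R]_(r * 2)) (P : set 'rV[R]_(r * 2)) :
  (2 <= r)%N -> (4 <= n)%N -> projectable_product n Pn phi P ->
  let Q := @pi4 R (r * 2) @` P in
  is_dpolytope 4 Q /\
  [/\ nfaces 0 Q = n ^ r, nfaces 1 Q = r * n ^ r,
      4 * nfaces 2 Q + 6 * n ^ r = 5 * r * n ^ r + 4 * r * n ^ (r - 1)
    & 4 * nfaces 3 Q + 2 * n ^ r = r * n ^ r + 4 * r * n ^ (r - 1)]%N.
Proof.
move=> r2 n4 pp Q; have [top [star [topE lat incomparable]]] := polygon_structure (factor_ngon pp).
split.
  split; first exact: (polytope_proj _ (realization_dim pp).1).
  exact: (proj_dim4 r2 n4 pp lat incomparable).
have [-> -> -> ->] := nfaces_counts r2 n4 pp lat incomparable.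
have [-> -> c10 c02 [c11 c03]] := shadow_counts r2 n4 pp topE lat incomparable.
have nE : (n ^ r = n * n ^ (r - 1))%N by rewrite -expnS; congr (_ ^ _)%N; lia.
have cancel x : (n * x = r * n ^ r)%N -> (x = r * n ^ (r - 1))%N.
  by move=> nx; apply/eqP; rewrite -(@eqn_pmul2l n) ?nx ?nE; [apply/eqP|]; lia.
by rewrite (cancel _ c10) (cancel _ c11); split=> //; lia.
Qed.

Theorem corollary5p2 (R : realType) :
  (forall (r n : nat) (Pn : set 'rV[R]_2)
     (phi : set 'rV[R]_(r * 2) -> set 'rV[R]_(r * 2))
     (P : set 'rV[R]_(r * 2)),
     (2 <= r)%N -> (4 <= n)%N -> ~~ odd n ->
     projectable_product n Pn phi P ->
     [/\ is_dpolytope 4 (@pi4 R (r * 2) @` P),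
         fvector (@pi4 R (r * 2) @` P) =
         row4 (n%:R ^+ r)
              (r%:R * n%:R ^+ r)
              (5 / 4 * r%:R * n%:R ^+ r - 3 / 2 * n%:R ^+ r
                 + r%:R * n%:R ^+ (r - 1))
              (1 / 4 * r%:R * n%:R ^+ r - 1 / 2 * n%:R ^+ r
                 + r%:R * n%:R ^+ (r - 1))
       & fvector (@pi4 R (r * 2) @` P) =
         (1 / 4 * r%:R * n%:R ^+ r) *:
         row4 (4 / r%:R)
              4
              (5 - 6 / r%:R + 4 / n%:R)
              (1 - 2 / r%:R + 4 / n%:R)]) /\
  (forall e : R, 0 < e ->
     exists N : nat,
       forall (r n : nat) (Pn : set 'rV[R]_2)
         (phi : set 'rV[R]_(r * 2) -> set 'rV[R]_(r * 2))
         (P : set 'rV[R]_(r * 2)),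
         (2 <= r)%N -> (4 <= n)%N -> ~~ odd n ->
         (N <= r)%N -> (N <= n)%N ->
         projectable_product n Pn phi P ->
         `|fatness (@pi4 R (r * 2) @` P) - 9| < e).
Proof.
have counts (r n : nat) (Pn : set 'rV[R]_2) phi P :
    (2 <= r)%N -> (4 <= n)%N -> projectable_product n Pn phi P ->
    let f i := (nfaces i (@pi4 R (r * 2) @` P))%:R : R in
    let M := n%:R ^+ (r - 1) in
    [/\ n%:R ^+ r = n%:R * M, f 0%N = n%:R * M, f 1%N = r%:R * (n%:R * M),
        f 2%N = 5 / 4 * r%:R * (n%:R * M) - 3 / 2 * (n%:R * M) + r%:R * M
      & f 3%N = 1 / 4 * r%:R * (n%:R * M) - 1 / 2 * (n%:R * M) + r%:R * M].
  move=> r2 n4 pp f M; have [_ [f0 f1 f2 f3]] := projection_f_vector r2 n4 pp.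
  have nM : n%:R ^+ r = n%:R * M.
    by rewrite /M -exprS; congr (_ ^+ _); lia.
  have := congr1 (fun k => k%:R : R) f2; rewrite natrD [in RHS]natrD !natrM !natrX nM.
  have := congr1 (fun k => k%:R : R) f3; rewrite natrD [in RHS]natrD !natrM !natrX nM.
  rewrite -/M -/(f 2%N) -/(f 3%N) => F3 F2; split=> //.
  - by rewrite /f f0 natrX nM.
  - by rewrite /f f1 natrM natrX nM.
  - by move: F2; clear; lra.
  - by move: F3; clear; lra.
split=> [r n Pn phi P r2 n4 _ pp|e e0].
  have [dimQ _] := projection_f_vector r2 n4 pp.
  have [nM f0 f1 f2 f3] := counts _ _ _ _ _ r2 n4 pp.
  have r0 : r%:R != 0 :> R by rewrite pnatr_eq0; lia.
  have n0 : n%:R != 0 :> R by rewrite pnatr_eq0; lia.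
  split=> //; apply/rowP => -[[|[|[|[|//]]]] lti]; rewrite !mxE /= ?f0 ?f1 ?f2 ?f3 nM //.
  - by field; rewrite ?r0 ?n0.
  - by field; rewrite ?r0 ?n0.
  - by field; rewrite ?r0 ?n0.
  - by field; rewrite ?r0 ?n0.
(* The difference of the fatness and 9 is a fraction with numerator at most
   11 n^r + 8 r n^(r-1) and denominator at least r n^r / 8, hence it is at
   most 88 / r + 64 / n; and 88 + 64 = 152. *)
exists (Num.bound (152 / e)) => r n Pn phi P r2 n4 _ Nr Nn pp.
have [nM f0 f1 f2 f3] := counts _ _ _ _ _ r2 n4 pp.
rewrite /fatness f0 f1 f2 f3; move: nM; set M := n%:R ^+ (r - 1) => nM.
have bound : 152 < e * (Num.bound (152 / e))%:R.
  rewrite -ltr_pdivrMl // mulrC; apply: archi_boundP; by rewrite divr_ge0 // ltW.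
have er : 152 < e * r%:R.
  by apply: lt_le_trans bound _; rewrite ler_pM2l // ler_nat.
have en : 152 < e * n%:R.
  by apply: lt_le_trans bound _; rewrite ler_pM2l // ler_nat.
have rge : 2 <= r%:R :> R by rewrite ler_nat.
have nge : 4 <= n%:R :> R by rewrite ler_nat.
have Mge : 4 <= M.
  rewrite /M -(expr1 4); apply: le_trans (_ : n%:R ^+ 1 <= _); first by rewrite expr1.
  by rewrite ler_weXn2l //; [lra|lia].
have Mge0 : 0 < M by lra.
set D := (X in `|_ / X - 9|); set U := (X in `|X / _ - 9|).
have NM : 16 <= n%:R * M by nra.
have rNM : 2 * (n%:R * M) <= r%:R * (n%:R * M) by rewrite ler_wpM2r //; lra.
have rM0 : 0 < r%:R * M by rewrite mulr_gt0 //; lra.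
have Dlow : r%:R * (n%:R * M) / 8 <= D by rewrite /D; lra.
have D0 : 0 < D by lra.
have -> : U / D - 9 = (U - 9 * D) / D by field; rewrite gt_eqF.
rewrite normrM normfV (gtr0_norm D0) ltr_pdivrMr //.
have UD : `|U - 9 * D| <= 11 * (n%:R * M) + 8 * (r%:R * M).
  by rewrite ler_norml /U /D; apply/andP; split; lra.
apply: le_lt_trans UD _; apply: lt_le_trans (_ : e * (r%:R * (n%:R * M) / 8) <= _); last first.
  by rewrite ler_pM2l.
have h1 : 152 * (n%:R * M) < e * r%:R * (n%:R * M) by rewrite ltr_pM2r //; lra.
have h2 : 152 * (r%:R * M) < e * n%:R * (r%:R * M) by rewrite ltr_pM2r.
have -> : e * (r%:R * (n%:R * M) / 8) = 11 / 152 * (e * r%:R * (n%:R * M))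
    + 8 / 152 * (e * n%:R * (r%:R * M)) by field.
by lra.
Qed.
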